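(* Let $k\in\mathbb C$ with $\Re(k)>0$, let $\vartheta$ be a root of unity, and let $f:\mathbb Q\to\mathbb C$ and $h:\mathbb R\setminus\{0\}\to\mathbb C$ satisfy $$f(x+1)=\vartheta f(x)\ \ (x\in\mathbb Q),\qquad h(x)=f(x)-\vartheta^{\pm3}|x|^{-k}f(-1/x)\ \ (\pm x\in\mathbb Q_{>0}).$$ For $x\in(0,1)$ irrational with $x=[0;b_1,b_2,\dots]$ set $$f^\ast(x):=\lim_{j\to\infty}\vartheta^{-3-\sum_{i=1}^{2j+1}(-1)^ib_i}\,\mathrm{den}(x_{2j+1})^{-k}f\big(\overline{x_{2j+1}}\big),$$ where $x_{2j+1}=[0;b_1,\dots,b_{2j+1}]$. Let $\phi:\mathbb C\to\mathbb R$ be an $\mathbb R$-linear form and assume that $h$ satisfies one of the following: (1* ) $h$ extends to a continuous function on $[-1,1]$, and either $\Im k=0$ and there exist $p\in\mathbb Z$ and $\alpha\in(-1,1)$ with $\phi(\vartheta^ph(\alpha))\neq0$; or $\Im k\neq0$ and there exists $\alpha\in(-1,1)$ with $h(\alpha)\neq0$. (2* ) For some choice of sign $\pm$ one has $\lim_{x\to0^\pm}|h(x)|=\infty$; there exists $\delta\in(0,1)$ with $h(x)\ll e^{|x|^{-1+\delta}}$ for $0<|x|\leq1$; and either $\Im k=0$ and there exists $p\in\mathbb Z$ such that for all sufficiently small $\varepsilon>0$, $$\liminf_{x\to0^\pm}\inf\Big\{\Big|\phi\Big(\vartheta^p\frac{h(x)-u^kh(ux)}{|h(x)|}\Big)\Big|\colon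 u>0,\ |\log u|\in(\varepsilon,\varepsilon^{2/3})\Big\}>0,$$ or $\Im k\neq0$ and there exists $\beta\in\mathbb R$ such that for all sufficiently small $\varepsilon>0$, $$\liminf_{x\to0^\pm}\inf\Big\{\Big|\phi\Big(e(\alpha)\frac{h(x)-u^kh(ux)}{|h(x)|}\Big)\Big|\colon u>0,\ |\log u|\in(\varepsilon,\varepsilon^{2/3}),\ \alpha\in\mathbb R,\ |\alpha-\beta|<\varepsilon^{2/3}\Big\}>0.$$ Then the limit defining $f^\ast$ exists for almost every $x\in(0,1)$, and the cumulative distribution function of $(\phi\circ f^\ast)_\ast(\nu)$ is continuous, where $\nu$ is Lebesgue measure on $[0,1]$.
   Context: $e(\alpha)=e^{2\pi i\alpha}$. $\mathrm{den}(y)$ is the denominator of a rational $y$; for $y=a/q$ reduced, $\overline y=\overline a_q/q$ with $\overline a_q\in(0,q]$, $a\overline a_q\equiv1\pmod q$. In (2* ) the same sign $\pm$ is used throughout.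
   Formalization: The linear form φ is assumed not identically zero; for φ = 0 the claim fails in case (1* ) with Im k ≠ 0, since φ∘f* is then 0 almost everywhere and its distribution function jumps at 0. *)

(* Defs.v *)
From HB Require Import structures.
From mathcomp Require Import all_boot all_order all_algebra.
From mathcomp Require Import all_classical all_reals all_analysis.
From mathcomp Require Import complex.
Set Implicit Arguments. Unset Strict Implicit. Unset Printing Implicit Defensive.
Import Order.TTheory GRing.Theory Num.Theory.
Local Open Scope ring_scope.

Section Defs.
Variable R : realType.

Definition cpow (x : R) (z : R[i]) : R[i] :=
  let t := complex.Im z * ln x in
  Complex (expR (complex.Re z * ln x) * cos t) (expR (complex.Re z * ln x) * sin t).

Definition eC (a : R) : R[i] := Complex (cos (2 * pi * a)) (sin (2 * pi * a)).

Definition cabs (z : R[i]) : R := Num.sqrt (complex.Re z ^+ 2 + complex.Im z ^+ 2).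

(* Gauss map and continued fraction digits: cf_digit x i = b_(i+1) for x = [0; b_1, b_2, ...] *)
Definition gauss (x : R) : R := x^-1 - (Num.floor (x^-1))%:~R.
Definition cf_digit (x : R) (i : nat) : int := Num.floor ((iter i gauss x)^-1).

Definition cf_eval (bs : seq int) : rat := foldr (fun b acc => 1 / (b%:~R + acc)) 0 bs.
Definition convergent (x : R) (n : nat) : rat := cf_eval (mkseq (cf_digit x) n).

(* overline y = abar / q, where y = a/q reduced and abar in (0,q], a*abar = 1 mod q *)
Definition bar_num (a : int) (q : nat) : nat :=
  (find (fun m : nat => (q%:Z %| a * (m.+1)%:Z - 1)%Z) (iota 0 q)).+1.
Definition rat_bar (y : rat) : rat :=
  let q := `|denq y|%N in ((bar_num (numq y) q)%:R / q%:R).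

Definition is_irrational (x : R) : Prop := forall q : rat, x <> ratr q.

Definition fstar_term (th k : R[i]) (f : rat -> R[i]) (x : R) (j : nat) : R[i] :=
  let n := (2 * j + 1)%N in
  let y := convergent x n in
  th ^ (- 3 - \sum_(1 <= i < n.+1) ((-1) ^+ i * cf_digit x i.-1))%R
  * cpow (denq y)%:~R (- k) * f (rat_bar y).

Definition ccvg_to (a : nat -> R[i]) (l : R[i]) : Prop :=
  forall e : R, 0 < e -> exists N : nat, forall j, (N <= j)%N -> cabs (a j - l) < e.

Definition fstar_is (th k : R[i]) (f : rat -> R[i]) (x : R) (l : R[i]) : Prop :=
  0 < x < 1 /\ is_irrational x /\ ccvg_to (fstar_term th k f x) l.

Definition ccont_on_11 (g : R -> R[i]) : Prop :=
  forall x, -1 <= x <= 1 -> forall e : R, 0 < e -> exists2 d : R, 0 < d &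
    forall y, -1 <= y <= 1 -> `|y - x| < d -> cabs (g y - g x) < e.

End Defs.

(* Main.v *)
Require Import Defs.
From HB Require Import structures.
From mathcomp Require Import all_boot all_order all_algebra.
From mathcomp Require Import all_classical all_reals all_analysis.
From mathcomp Require Import complex ring lra zify.
Import Order.TTheory GRing.Theory Num.Theory.
Import numFieldNormedType.Exports.
Local Open Scope ring_scope.

(** Write x = [0; b_1, b_2, ...] with convergents p_m / q_m.  The inverse of p_m
    modulo q_m is q_(m-1) when m is odd, so unfolding the relation between f and h
    along the digits turns the terms defining f-star into partial sums of the series
      S = f(0) + sum_m th^(e_m) q_m^(-k) h((-1)^(m-1) q_(m-1) / q_m).
    Both (1-star) and (2-star) bound |h(y)| by C exp(|y|^(dl-1)), while q_m grows
    geometrically and b_m >= X has probability O(1/X) inside any cylinder of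
    smaller depth.  Hence the series converges almost everywhere and, on at least
    half of every cylinder of depth m, its tail beyond m is O(q_m^(-Re k)).

    Suppose that {phi f-star = t} has positive measure.  Near one of its density
    points, every long prefix P and every word W of bounded size then satisfy
      phi(S(P W)) = t + O(q_(P W)^(-Re k)),
    where S(P W) is the partial sum along the digits P W.
    Under (2-star), compare W = c and W = c' with c = c' modulo the order of th:
    with u = q_(P c) / q_(P c') the last arguments of h are exactly x and u x, and
    S(P c) - S(P c') = th^e q_(P c)^(-k) (h(x) - u^k h(u x)), which is too large
    since |h(x)| is unbounded.  Under (1-star) h is bounded, so that a further huge
    digit makes the error term negligible against the last term of S(P W), whose
    argument of h can be brought close to alpha.  In both cases the phase
    th^e q^(-i Im k) is adjusted through the choice of one digit of W: through
    its residue modulo the order of th if Im k = 0, through its size otherwise. *)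

Set Implicit Arguments. Unset Strict Implicit. Unset Printing Implicit Defensive.

(** * Modulus, phase and powers of complex numbers *)

Section ComplexFacts.
Variable R : realType.
Implicit Types (x y : R) (z w : R[i]).

Lemma cabsE z : cabs z = Normc.normc z.
Proof. by case: z. Qed.

Lemma cabs_ge0 z : 0 <= cabs z.
Proof. exact: sqrtr_ge0. Qed.

Lemma cabsM z w : cabs (z * w) = cabs z * cabs w.
Proof. by rewrite !cabsE Normc.normcM. Qed.

Lemma cabsD z w : cabs (z + w) <= cabs z + cabs w.
Proof. by rewrite !cabsE; apply: le_normcD. Qed.

Lemma cabsN z : cabs (- z) = cabs z.
Proof. by rewrite !cabsE normcN. Qed.

Lemma cabsBC z w : cabs (z - w) = cabs (w - z).
Proof. by rewrite -cabsN opprB. Qed.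

Lemma cabs_distD v z w : cabs (z - w) <= cabs (z - v) + cabs (v - w).
Proof. by rewrite -[z - w](subrKA v); apply: cabsD. Qed.

Lemma cabs0 : cabs (0 : R[i]) = 0.
Proof. by rewrite cabsE Normc.normc0. Qed.

Lemma cabs1 : cabs (1 : R[i]) = 1.
Proof. by rewrite cabsE Normc.normc1. Qed.

Lemma cabs_eq0 z : cabs z = 0 -> z = 0.
Proof. by rewrite cabsE; apply: Normc.eq0_normc. Qed.

Lemma cabsV z : cabs z^-1 = (cabs z)^-1.
Proof. by rewrite !cabsE Normc.normcV. Qed.

Lemma cabs_real x : cabs (x%:C)%C = `|x|.
Proof. by rewrite /cabs /= expr0n /= addr0 sqrtr_sqr. Qed.

Lemma cabs_ge_Re z : `|complex.Re z| <= cabs z.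
Proof. by rewrite -sqrtr_sqr ler_wsqrtr // lerDl sqr_ge0. Qed.

Lemma cabs_ge_Im z : `|complex.Im z| <= cabs z.
Proof. by rewrite -sqrtr_sqr ler_wsqrtr // lerDr sqr_ge0. Qed.

Lemma cabs_le_ReIm z : cabs z <= `|complex.Re z| + `|complex.Im z|.
Proof.
rewrite -[leRHS]ger0_norm ?addr_ge0 // -sqrtr_sqr ler_wsqrtr //.
rewrite sqrrD !real_normK ?num_real // lerD2r lerDl mulrn_wge0 //.
Qed.

Lemma cabsX z n : cabs (z ^+ n) = cabs z ^+ n.
Proof. by elim: n => [|n IH]; rewrite ?cabs1 // !exprS cabsM IH. Qed.

Lemma cabs_root z n : (0 < n)%N -> z ^+ n = 1 -> cabs z = 1.
Proof.
move=> n0 /(congr1 (@cabs R)); rewrite cabsX cabs1 => /eqP.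
by rewrite pexpr_eq1 ?cabs_ge0 // => /eqP.
Qed.

Lemma cabs_exprz z (n : int) : cabs z = 1 -> cabs (z ^ n) = 1.
Proof.
by move=> z1; case: n => n; rewrite ?NegzE ?exprnP -?exprnN ?cabsV ?cabsX z1 ?expr1n ?invr1.
Qed.

Lemma eCD x y : eC (x + y) = eC x * eC y.
Proof.
rewrite /eC mulrDr cosD sinD; apply/eqP; rewrite eq_complex /= eqxx /=.
by rewrite addrC.
Qed.

Lemma eC0 : eC (0 : R) = 1.
Proof. by rewrite /eC mulr0 cos0 sin0. Qed.

Lemma eC1 : eC (1 : R) = 1.
Proof. by rewrite /eC mulr1 mulrC -mulr_natr mul1r mulr_natr cos2pi sin2pi. Qed.

Lemma eC_int (n : int) : eC (n%:~R : R) = 1.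
Proof.
have H m : eC (m%:R : R) = 1.
  by elim: m => [|m IH]; rewrite ?eC0 // -natr1 eCD IH eC1 mulr1.
case: n => n; first exact: H.
have := eCD (Negz n)%:~R (n.+1)%:R; rewrite H mulr1 => <-.
by rewrite NegzE mulrNz addNr eC0.
Qed.

Lemma cabs_eC x : cabs (eC x) = 1.
Proof. by rewrite /cabs /= cos2Dsin2 sqrtr1. Qed.

Lemma cabs1_eC z : cabs z = 1 -> exists x, z = eC x.
Proof.
case: z => a b z1.
have ab1 : a ^+ 2 + b ^+ 2 = 1.
  move: z1; rewrite /cabs /= => /(congr1 (fun t => t ^+ 2)).
  by rewrite sqr_sqrtr ?addr_ge0 ?sqr_ge0 // expr1n.
have a1 : -1 <= a <= 1 by apply/andP; split; nra.
have sE : sin (acos a) = `|b|.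
  rewrite sin_acos //; have -> : 1 - a ^+ 2 = b ^+ 2 by rewrite -ab1; ring.
  by rewrite sqrtr_sqr.
have p0 : 2 * pi != 0 :> R by rewrite mulf_neq0 // gt_eqF // pi_gt0.
(* [acos a] determines the angle only up to sign; the sign of [b] decides. *)
have [b0|b0] := leP 0 b.
  exists (acos a / (2 * pi)).
  by rewrite /eC mulrC divfK // acosK // sE ger0_norm.
exists (- acos a / (2 * pi)).
by rewrite /eC mulrC divfK // cosN sinN acosK // sE ltr0_norm // opprK.
Qed.

Lemma cpow_polar x z : cpow x z =
  ((expR (complex.Re z * ln x))%:C * eC (complex.Im z * ln x / (2 * pi)))%C.
Proof.
have p0 : 2 * pi != 0 :> R by rewrite mulf_neq0 // gt_eqF // pi_gt0.
apply/eqP; rewrite /cpow /eC eq_complex /= mulrC.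
have -> : 2 * pi * (complex.Im z * ln x / (2 * pi)) = complex.Im z * ln x.
  by rewrite mulrC divfK.
by rewrite !mul0r subr0 addr0 eqxx andbT mulrC eqxx.
Qed.

Lemma cabs_cpow x z : cabs (cpow x z) = expR (complex.Re z * ln x).
Proof. by rewrite cpow_polar cabsM cabs_eC cabs_real mulr1 ger0_norm ?expR_ge0. Qed.

Lemma cpowM x y z : 0 < x -> 0 < y -> cpow (x * y) z = cpow x z * cpow y z.
Proof.
move=> x0 y0; rewrite !cpow_polar lnM ?posrE // !mulrDr expRD mulrDl eCD.
rewrite rmorphM /=; ring.
Qed.

Lemma cpow1 z : cpow 1 z = 1.
Proof. by rewrite cpow_polar ln1 !mulr0 mul0r expR0 eC0 mulr1. Qed.

End ComplexFacts.

(** * Real-linear forms on the complex plane *)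

Section RealLinearForm.
Variables (R : realType) (phi : R[i] -> R).
Hypothesis phi_lin :
  forall (r : R) (z w : R[i]), phi ((r%:C)%C * z + w) = r * phi z + phi w.

Lemma phi0 : phi 0 = 0.
Proof. by have := phi_lin 1 0 0; rewrite mulr0 addr0 mul1r => /esym/eqP; rewrite -subr_eq0 addrK => /eqP. Qed.

Lemma phiZ r z : phi ((r%:C)%C * z) = r * phi z.
Proof. by rewrite -[X in phi X]addr0 phi_lin phi0 addr0. Qed.

Lemma phiD z w : phi (z + w) = phi z + phi w.
Proof. by have := phi_lin 1 z w; rewrite !mul1r. Qed.

Lemma phiN z : phi (- z) = - phi z.
Proof. by apply/eqP; rewrite -subr_eq0 opprK -phiD addNr phi0. Qed.

Lemma phiB z w : phi (z - w) = phi z - phi w.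
Proof. by rewrite phiD phiN. Qed.

(** The values at 1 and i control the form; the additional 1 in the constant makes [L] positive, so
    that later steps may divide by it. *)
Lemma phi_bound : exists2 L : R, 0 < L & forall z, `|phi z| <= L * cabs z.
Proof.
exists (1 + `|phi 1| + `|phi (Complex 0 1)|) => [|z].
  by rewrite -addrA ltr_pwDl // addr_ge0.
have -> : phi z = complex.Re z * phi 1 + complex.Im z * phi (Complex 0 1).
  rewrite -!phiZ -phiD; congr phi; case: z => a b; apply/eqP.
  by rewrite eq_complex /= !mul0r !mulr0 !mulr1 !(subr0, addr0, add0r) !eqxx.
apply: (le_trans (ler_normD _ _)); rewrite !normrM.
have H1 : `|complex.Re z| * `|phi 1| <= cabs z * `|phi 1|.
  by rewrite ler_wpM2r // cabs_ge_Re.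
have H2 : `|complex.Im z| * `|phi (Complex 0 1)| <= cabs z * `|phi (Complex 0 1)|.
  by rewrite ler_wpM2r // cabs_ge_Im.
have := cabs_ge0 z; nra.
Qed.

End RealLinearForm.

(** * Cauchy sequences and geometric series of complex numbers *)

Section ComplexLimits.
Local Open Scope classical_set_scope.
Variable R : realType.
Implicit Types (u : nat -> R[i]) (l z : R[i]).

Lemma cauchy_cvg_real (a : R^nat) :
    (forall e, 0 < e -> exists N, forall j, `|a (N + j)%N - a N| < e) ->
  exists l : R, forall e, 0 < e -> exists N, forall n, (N <= n)%N -> `|a n - l| < e.
Proof.
move=> H; have : cvgn a.
  apply/cauchy_cvgP/cauchy_exP => e e0; have [N HN] := H e e0.
  exists (a N); exists N => // n /= nN; rewrite -ball_normE /= distrC.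
  by rewrite -(subnKC nN).
move=> /cvg_ex[l /cvgrPdist_lt al]; exists l => e /al[N _ HN].
by exists N => n nN; rewrite distrC; apply: HN.
Qed.

Lemma cauchy_cvg_complex (u : nat -> R[i]) :
    (forall e, 0 < e -> exists N, forall j, cabs (u (N + j)%N - u N) < e) ->
  exists l, ccvg_to u l.
Proof.
move=> H.
have [|a ca] := @cauchy_cvg_real (fun n => complex.Re (u n)).
  move=> e /H[N HN]; exists N => j; apply: le_lt_trans (HN j).
  by apply: le_trans (cabs_ge_Re _); case: (u (N + j)%N) => ? ?; case: (u N) => ? ?.
have [|b cb] := @cauchy_cvg_real (fun n => complex.Im (u n)).
  move=> e /H[N HN]; exists N => j; apply: le_lt_trans (HN j).
  by apply: le_trans (cabs_ge_Im _); case: (u (N + j)%N) => ? ?; case: (u N) => ? ?.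
exists (Complex a b) => e e0; have e20 : 0 < e / 2 by rewrite divr_gt0.
have [N HN] := ca _ e20; have [M HM] := cb _ e20; exists (maxn N M) => n.
rewrite geq_max => /andP[nN nM].
have := HN n nN; have := HM n nM => h1 h2.
apply: le_lt_trans (cabs_le_ReIm _) _.
move: h1 h2; case: (u n) => x y /= h1 h2; lra.
Qed.

Lemma geometric_tail u (K r : R) : 0 <= K -> 0 < r < 1 ->
    (forall n, cabs (u n.+1 - u n) <= K * r ^+ n) ->
  forall n j, cabs (u (n + j)%N - u n) <= K / (1 - r) * r ^+ n.
Proof.
move=> K0 /andP[r0 r1] H n j; have r1' : 0 < 1 - r by rewrite subr_gt0.
(* Keeping the subtracted power makes the induction on j telescope. *)
suff : cabs (u (n + j)%N - u n) <= K / (1 - r) * (r ^+ n - r ^+ (n + j)).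
  move=> /le_trans; apply; apply: ler_wpM2l; first by rewrite divr_ge0 // ltW.
  by rewrite gerBl exprn_ge0 // ltW.
elim: j => [|j IH]; first by rewrite addn0 !subrr cabs0 mulr0.
rewrite addnS; apply: le_trans (cabs_distD (u (n + j)%N) _ _) _.
apply: le_trans (lerD (H _) IH) _; rewrite le_eqVlt; apply/orP; left; apply/eqP.
by rewrite exprS; field; rewrite gt_eqF.
Qed.

Lemma geometric_cvg u (K r : R) : 0 <= K -> 0 < r < 1 ->
    (forall n, cabs (u n.+1 - u n) <= K * r ^+ n) ->
  exists2 l, ccvg_to u l & forall n, cabs (u n - l) <= K / (1 - r) * r ^+ n.
Proof.
move=> K0 rr H; have T := geometric_tail K0 rr H; have /andP[r0 r1] := rr.
have [l cl] : exists l, ccvg_to u l.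
  apply: cauchy_cvg_complex => e e0.
  have : (fun n => K / (1 - r) * r ^+ n) @ \oo --> (0 : R).
    rewrite -[X in _ --> X](mulr0 (K / (1 - r))); apply: cvgMr.
    by apply: cvg_expr; rewrite gtr0_norm.
  move=> /cvgrPdist_lt/(_ _ e0)[N _ HN]; exists N => j; apply: le_lt_trans (T N j) _.
  by have := HN N (leqnn N); rewrite /= sub0r normrN; apply: le_lt_trans; exact: ler_norm.
exists l => // n; apply/ler_addgt0Pr => e e0; have [N HN] := cl _ e0.
apply: le_trans (cabs_distD (u (n + N)%N) _ _) _; rewrite lerD //; last first.
  by apply/ltW/HN; rewrite leq_addl.
by rewrite cabsBC.
Qed.

Lemma ccvg_unique u l1 l2 : ccvg_to u l1 -> ccvg_to u l2 -> l1 = l2.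
Proof.
move=> c1 c2; apply/eqP; rewrite -subr_eq0; apply/eqP/cabs_eq0/eqP.
rewrite eq_le cabs_ge0 andbT; apply/ler_addgt0Pr => e e0; rewrite add0r.
have e20 : 0 < e / 2 by rewrite divr_gt0.
have [N HN] := c1 _ e20; have [M HM] := c2 _ e20; pose n := maxn N M.
apply: le_trans (cabs_distD (u n) _ _) _; rewrite (splitr e) lerD // ltW //.
  by rewrite cabsBC HN // leq_maxl.
by rewrite HM // leq_maxr.
Qed.

End ComplexLimits.

(** * Continuants *)

(* Words of digits are stored with the latest digit first:
   b_m :: ... :: b_1 :: nil stands for [0; b_1, ..., b_m]. *)
Fixpoint cont (u v : int) (r : seq int) : int * int :=
  if r is b :: s then (b * (cont u v s).1 + (cont u v s).2, (cont u v s).1)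
  else (u, v).

(** The seeds (q_0, q_(-1)) = (1, 0) and (p_0, p_(-1)) = (0, 1) start the two continuant recursions;
    a prime marks the preceding index. *)
Definition cq r := (cont 1 0 r).1.
Definition cq' r := (cont 1 0 r).2.
Definition cp r := (cont 0 1 r).1.
Definition cp' r := (cont 0 1 r).2.

Local Notation posw := (all (fun b : int => 0 < b)).

(** With the latest digit first this is [0; b_m, ..., b_1] = q_(m-1) / q_m; the convergent itself is
    [cf_eval (rev r)]. *)
Definition cy (r : seq int) : rat := cf_eval r.

Lemma cq_cons b r : cq (b :: r) = b * cq r + cq' r. Proof. by []. Qed.
Lemma cq'_cons b r : cq' (b :: r) = cq r. Proof. by []. Qed.
Lemma cp_cons b r : cp (b :: r) = b * cp r + cp' r. Proof. by []. Qed.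
Lemma cp'_cons b r : cp' (b :: r) = cp r. Proof. by []. Qed.
Lemma cy_cons b r : cy (b :: r) = 1 / (b%:~R + cy r). Proof. by []. Qed.

Lemma cq_bounds r : posw r -> [/\ 0 < cq r, 0 <= cq' r & cq' r <= cq r].
Proof.
elim: r => [//|b r IH] /= /andP[b0 /IH[q0 q'0 qq]]; rewrite cq_cons cq'_cons.
split; nia.
Qed.

Lemma cq_gt0 r : posw r -> 0 < cq r. Proof. by case/cq_bounds. Qed.

(** Two further digits at least double the denominator. After squaring this is a factor 2 per digit,
    and the 2 on the right pays for an unpaired digit; the induction therefore removes digits in
    pairs. *)
Lemma cq_growth l r : posw (l ++ r) -> 2 ^+ size l * cq r ^+ 2 <= 2 * cq (l ++ r) ^+ 2.
Proof.
have [n] := ubnP (size l); elim: n l => // n IH [|b [|c l]] /=.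
- by move=> _ /cq_gt0 q0; rewrite expr0 mul1r; nia.
- move=> _ /andP[b0 /cq_bounds[q0 q0' qq]]; rewrite cq_cons expr1 ler_pM2l //.
  have H : cq r <= b * cq r + cq' r by nia.
  by rewrite !expr2; nia.
move=> sl /and3P[b0 c0 pl]; have := IH l; rewrite ltnS in sl.
move=> /(_ (leq_trans (leqnSn _) sl) pl); have [q0 q0' qq] := cq_bounds pl.
rewrite !cq_cons cq'_cons !exprS => H.
have H1 : cq (l ++ r) <= c * cq (l ++ r) + cq' (l ++ r) by nia.
have H2 : 2 * cq (l ++ r) <= b * (c * cq (l ++ r) + cq' (l ++ r)) + cq (l ++ r).
  by move: H1 q0; set z := (X in _ <= X); nia.
set u := (X in _ <= X) in H2.
have H3 : 4 * cq (l ++ r) ^+ 2 <= u ^+ 2 by nia.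
move: H H3; rewrite !expr2 -/u; set w := 2 ^+ size l; nia.
Qed.

Lemma cq_upper l r (M : int) : 0 < M -> posw (l ++ r) -> all (fun b => b <= M) l ->
  cq (l ++ r) <= (M + 1) ^+ size l * cq r.
Proof.
move=> M0; elim: l => [|b l IH] /=; first by rewrite expr0 mul1r.
move=> /andP[b0 pl] /andP[bM /(IH pl)]; have [q0 q0' qq] := cq_bounds pl.
rewrite cq_cons exprS -mulrA; set w := _ ^+ _ * _; nia.
Qed.

Lemma cont_det r : cp' r * cq r - cp r * cq' r = (-1) ^+ size r.
Proof.
elim: r => [//|b r IH] /=; rewrite cq_cons cp_cons cq'_cons cp'_cons exprS -IH; ring.
Qed.

(** The recursion is linear in its two seeds, so the word [l] acts on the pair reached by [r] as a 2
    by 2 matrix. *)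
Lemma cq_cat l r : cq (l ++ r) = cq l * cq r + cp l * cq' r /\
                   cq' (l ++ r) = cq' l * cq r + cp' l * cq' r.
Proof.
elim: l => [|b l [IH1 IH2]] /=.
  by rewrite /cq /cp /cq' /cp' /= !mul1r !mul0r addr0 add0r.
rewrite !cq_cons !cq'_cons cp_cons cp'_cons IH1 IH2; split; ring.
Qed.

(** The last bound excludes the empty word, where [cp'] is 1 and [cq'] is 0. *)
Lemma cp_le_cq r : posw r -> [/\ 0 <= cp r, 0 <= cp' r, cp r <= cq r & r != [::] -> cp' r <= cq' r].
Proof.
elim: r => [//|b r IH] /andP[b0 pr]; have [q0 q0' qq] := cq_bounds pr.
have [p0 p0' pq pq'] := IH pr; rewrite cq_cons cp_cons cq'_cons cp'_cons; split => //; first nia.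
case: r {IH pr} q0 q0' qq p0 p0' pq pq' => [|c r] q0 q0' qq p0 p0' pq; last by move=> /(_ isT); nia.
by rewrite /cp /cp' /cq /cq' /= => _; lia.
Qed.

(** * Digit words as Moebius maps, and reduced fractions *)

Section ContinuedFractionValues.
Variable F : numFieldType.

(** This is the map t -> [0; b_1, ..., b_m + t], in which t stands for the part of the expansion
    beyond the word. *)
Definition mob (r : seq int) (t : F) : F :=
  foldl (fun acc b => 1 / (b%:~R + acc)) t r.

Lemma mob_cons b r t : mob (b :: r) t = mob r (1 / (b%:~R + t)).
Proof. by []. Qed.

Lemma mobE r t : posw r -> 0 <= t ->
  mob r t = ((cp r)%:~R + t * (cp' r)%:~R) / ((cq r)%:~R + t * (cq' r)%:~R).
Proof.
elim: r t => [|b r IH] t.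
  by rewrite /mob /cp /cp' /cq /cq' /= !(mulr0, mulr1, addr0, add0r, divr1).
move=> /andP[b0 pr] t0; have [q0 q0' qq] := cq_bounds pr.
have b0' : 0 < b%:~R + t by rewrite ltr_wpDr // ltr0z.
rewrite mob_cons IH //; last by rewrite divr_ge0 // ltW.
rewrite cq_cons cp_cons cq'_cons cp'_cons !rmorphD !rmorphM /=.
have q0F : 0 < (cq r)%:~R :> F by rewrite ltr0z.
have q0'F : 0 <= (cq' r)%:~R :> F by rewrite ler0z.
field; rewrite !gt_eqF //=.
by rewrite addrAC -mulrDl ltr_wpDr // mulr_gt0.
Qed.

End ContinuedFractionValues.

Lemma cf_eval_rev r : cf_eval (rev r) = mob r (0 : rat).
Proof. by rewrite /cf_eval -foldl_rev revK. Qed.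

Lemma cyE r : posw r -> cy r = (cq' r)%:~R / (cq r)%:~R.
Proof.
elim: r => [|b r IH]; first by rewrite /cy /cq' /= mul0r.
move=> /andP[b0 pr]; have [q0 q0' qq] := cq_bounds pr; rewrite cy_cons IH // cq_cons cq'_cons.
have q0F : 0 < (cq r)%:~R :> rat by rewrite ltr0z.
have q0'F : 0 <= (cq' r)%:~R :> rat by rewrite ler0z.
have b0F : 0 < b%:~R :> rat by rewrite ltr0z.
rewrite rmorphD rmorphM /=; field; rewrite !gt_eqF ?ltr_wpDr ?mulr_gt0 //.
Qed.

Lemma cy_bounds r : posw r -> 0 <= cy r <= 1.
Proof.
move=> pr; have [q0 q0' qq] := cq_bounds pr; rewrite cyE //.
by rewrite divr_ge0 ?ler0z ?(ltW q0) //= ler_pdivrMr ?ltr0z // mul1r ler_int.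
Qed.

Lemma cy_gt0 b r : posw (b :: r) -> 0 < cy (b :: r).
Proof.
by move=> /andP[b0 /cy_bounds/andP[y0 _]]; rewrite cy_cons divr_gt0 // ltr_wpDr // ltr0z.
Qed.

(** The determinant identity is a Bezout relation between [cp r] and [cq r], so their quotient is
    already reduced. *)
Lemma convergent_denq r : posw r -> denq (cf_eval (rev r)) = cq r /\ numq (cf_eval (rev r)) = cp r.
Proof.
move=> pr; have [q0 q0' qq] := cq_bounds pr.
rewrite cf_eval_rev mobE // !mul0r !addr0.
have cop : coprime `|cp r| `|cq r|.
  rewrite -coprimezE; apply/coprimezP; exists ((-1) ^+ size r * - cq' r, (-1) ^+ size r * cp' r) => /=.
  transitivity ((-1) ^+ size r * (cp' r * cq r - cp r * cq' r)); first by ring.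
  by rewrite cont_det -expr2 sqrr_sign.
have qE : `|cq r|%:Z = cq r by rewrite gez0_abs // ltW.
have := coprimeq_den cop; have := coprimeq_num cop.
by rewrite gt_eqF // gtr0_sg // mul1r gtr0_norm // => -> ->.
Qed.

Lemma bar_num_unique (a q : int) (c : int) : 0 < q -> 0 < c <= q -> (q %| a * c - 1)%Z ->
  (bar_num a `|q|)%:Z = c.
Proof.
move=> q0 /andP[c0 cq] dv; rewrite /bar_num.
have qE : `|q|%N%:Z = q by rewrite gez0_abs // ltW.
set P := (fun m : nat => _).
have PE m : P m = (q %| a * (m.+1)%:Z - 1)%Z by rewrite /P qE.
have hc : (`|c|.-1 < `|q|)%N by lia.
have cE : (`|c|.-1.+1)%:Z = c by lia.
have hP : P `|c|.-1 by rewrite PE cE.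
have has_P : has P (iota 0 `|q|) by apply/hasP; exists `|c|.-1 => //; rewrite mem_iota.
have fl : (find P (iota 0 `|q|) < `|q|)%N by rewrite -[X in (_ < X)%N](size_iota 0) -has_find.
have := nth_find 0%N has_P; rewrite nth_iota // add0n; set m := find _ _ in fl *.
rewrite PE => dm; rewrite -cE; congr (Posz _.+1).
(* This combination eliminates [a]: two inverses in (0, q] differ by a multiple of q smaller than
   q. *)
have : (q %| c * ((a * m.+1%:Z - 1)) - m.+1%:Z * (a * c - 1))%Z.
  by rewrite rpredB // dvdz_mull.
have -> : c * (a * m.+1%:Z - 1) - m.+1%:Z * (a * c - 1) = m.+1%:Z - c by ring.
case/dvdzP => z zE; have : z = 0 by nia.
by move=> z0; move: zE; rewrite z0 mul0r; lia.
Qed.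

(** For odd length the determinant identity reads p_m q_(m-1) - p_(m-1) q_m = 1, so q_(m-1) inverts
    p_m. The word is then nonempty, which makes q_(m-1) positive. *)
Lemma convergent_bar r : posw r -> odd (size r) -> rat_bar (cf_eval (rev r)) = cy r.
Proof.
move=> pr or; have [dE nE] := convergent_denq pr; have [q0 q0' qq] := cq_bounds pr.
rewrite /rat_bar dE nE cyE //.
have det := cont_det r; rewrite -signr_odd or expr1 in det.
have q'0 : 0 < cq' r.
  case: r {dE nE det q0 q0' qq} pr or => [//|b r] /= /andP[_ pr] _; exact: cq_gt0.
have := @bar_num_unique (cp r) (cq r) (cq' r) q0; rewrite q'0 qq => /(_ isT).
move=> bE; have {}bE := bE _.
have {}bE : (bar_num (cp r) `|cq r|)%:Z = cq' r.
  apply: bE; apply/dvdzP; exists (cp' r); rewrite -[1]opprK -det; ring.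
by rewrite !pmulrn bE gez0_abs // ltW.
Qed.

(** * Partial sums of the series for f-star *)

Fixpoint alt (r : seq int) : int :=
  if r is b :: s then alt s + (-1) ^+ (size s).+1 * b else 0.

(** At odd length this is the exponent of [th] in [fstar_term]. Without the -3 at even length, the
    change from one length to the next contains exactly the exponent 3 or -3 of the relation between
    f and h. *)
Definition ex (r : seq int) : int := (if odd (size r) then -3 else 0) - alt r.

Section Digits.
Variable R : realType.

Definition dg (x : R) (n : nat) : seq int := rev (mkseq (cf_digit x) n).

Lemma dgS x n : dg x n.+1 = cf_digit x n :: dg x n.
Proof. by rewrite /dg /mkseq -[n.+1]addn1 iotaD map_cat rev_cat. Qed.

Lemma size_dg x n : size (dg x n) = n.
Proof. by rewrite size_rev size_mkseq. Qed.

Lemma alt_dg x n : alt (dg x n) = \sum_(1 <= i < n.+1) ((-1) ^+ i * cf_digit x i.-1).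
Proof.
elim: n => [|n IH]; first by rewrite big_geq.
by rewrite big_nat_recr //= -IH dgS /= size_dg.
Qed.

End Digits.

Section PartialSums.
Variables (R : realType) (k th : R[i]) (f : rat -> R[i]) (h : R -> R[i]).
Hypothesis th_root : exists n : nat, (0 < n)%N /\ th ^+ n = 1.
Hypothesis f_shift : forall x : rat, f (x + 1) = th * f x.
Hypothesis h_pos : forall x : rat, 0 < x ->
  h (ratr x) = f x - th ^ 3%:Z * cpow (ratr `|x|) (- k) * f (- x^-1).
Hypothesis h_neg : forall x : rat, x < 0 ->
  h (ratr x) = f x - th ^ (- 3)%Z * cpow (ratr `|x|) (- k) * f (- x^-1).

Definition trm (r : seq int) : R[i] :=
  th ^ ex r * cpow (cq r)%:~R (- k) * h ((-1) ^+ (size r).+1 * ratr (cy r)).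

Lemma trmE r : trm r =
  th ^ ex r * cpow (cq r)%:~R (- k) * h ((-1) ^+ (size r).+1 * ratr (cy r)).
Proof. by []. Qed.

Fixpoint psum (r : seq int) : R[i] :=
  if r is _ :: s then psum s + trm r else f 0.

Lemma psum_cons b s : psum (b :: s) = psum s + trm (b :: s). Proof. by []. Qed.

Lemma cabs_th : cabs th = 1.
Proof. by have [n [n0 /(cabs_root n0)]] := th_root. Qed.

Lemma th_neq0 : th != 0.
Proof. by apply/eqP => th0; have := cabs_th; rewrite th0 cabs0 => /eqP; rewrite eq_sym oner_eq0. Qed.

Lemma f_shift_int (x : rat) (z : int) : f (x + z%:~R) = th ^ z * f x.
Proof.
have H (y : rat) (n : nat) : f (y + n%:R) = th ^+ n * f y.
  elim: n => [|n IH]; first by rewrite addr0 mul1r.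
  by rewrite -natr1 addrA f_shift IH exprS mulrA.
case: z => n; first exact: H.
have := H (x + (Negz n)%:~R) n.+1.
rewrite NegzE mulrNz subrK => ->; rewrite mulrA -exprnN.
by rewrite mulVf ?mul1r // expf_neq0 // th_neq0.
Qed.

Lemma cabs_trm r : cabs (trm r) =
  expR (- complex.Re k * ln (cq r)%:~R) * cabs (h ((-1) ^+ (size r).+1 * ratr (cy r))).
Proof.
rewrite /trm !cabsM cabs_exprz ?cabs_th // mul1r cabs_cpow.
by case: (k).
Qed.

(** The relation between f and h is used once per digit, at x = (-1)^(m-1) q_(m-1) / q_m. There -1/x
    differs by b_m, up to sign, from the argument of the shorter word, and the shift rule turns this
    integer into a power of [th]. *)
Lemma psum_closed r : posw r ->
  th ^ ex r * cpow (cq r)%:~R (- k) * f ((-1) ^+ (size r).+1 * cy r) = psum r.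
Proof.
elim: r => [_|b s IH]; first by rewrite /ex /= /cy /cq /= cpow1 !mul1r mulN1r oppr0.
move=> pr; rewrite psum_cons -IH; last by case/andP: pr.
have y0 : 0 < cy (b :: s) by exact: cy_gt0.
have /andP[b0 ps] := pr.
(* The next identity, q_m |x| = q_(m-1), turns q_m^(-k) |x|^(-k) into q_(m-1)^(-k). *)
have q0 : 0 < (cq (b :: s))%:~R :> R by rewrite ltr0z cq_gt0.
have qy : (cq (b :: s))%:~R * ratr (cy (b :: s)) = (cq s)%:~R :> R.
  rewrite cyE // cq'_cons fmorph_div /= !ratr_int mulrC divfK //.
  by rewrite gt_eqF.
have y0R : 0 < ratr (cy (b :: s)) :> R by rewrite ltr0q.
have yV : (cy (b :: s))^-1 = b%:~R + cy s by rewrite cy_cons div1r invrK.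
rewrite /trm -qy cpowM //; set r := b :: s in pr y0 q0 qy y0R yV *.
set y := cy r in y0 qy y0R yV *; move: y y0 qy y0R yV => y y0 qy y0R yV.
have thE : th ^ ex s = th ^ ex r * th ^ (if odd (size s) then (- 3)%Z else 3%:Z) *
    th ^ (if odd (size s) then b else - b).
  rewrite -!expfzDr ?th_neq0 //; congr (_ ^ _).
  rewrite /ex /r /= -signr_odd /=; case: (odd (size s)) => /=; rewrite ?expr0 ?expr1; ring.
rewrite thE {thE} -[(-1) ^+ (size r).+1]signr_odd -[X in _ + _ * h (X * _)]signr_odd.
rewrite -[(-1) ^+ (size s).+1]signr_odd /=.
have key (T C1 C2 T1 T2 F G H : R[i]) : H = F - T1 * C2 * (T2 * G) ->
    T * C1 * F = T * T1 * T2 * (C1 * C2) * G + T * C1 * H.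
  by move=> ->; ring.
case: (odd (size s)) => /=; rewrite ?expr0 ?expr1 !(mul1r, mulN1r); apply: key.
- rewrite -[- ratr _](rmorphN (ratr : rat -> R)).
  rewrite h_neg ?oppr_lt0 // normrN gtr0_norm // invrN opprK yV.
  by rewrite [b%:~R + _]addrC f_shift_int.
- rewrite h_pos // gtr0_norm // yV opprD -[- b%:~R]mulrNz.
  by rewrite [(- b)%:~R - cy s]addrC f_shift_int.
Qed.

Lemma fstar_term_psum (x : R) j : posw (dg x (2 * j + 1)) ->
  fstar_term th k f x j = psum (dg x (2 * j + 1)).
Proof.
set n := (2 * j + 1)%N => pd.
have on : odd n by rewrite /n addn1 /= mul2n odd_double.
rewrite -psum_closed // size_dg exprS -signr_odd on mulN1r opprK mul1r.
rewrite /fstar_term -/n /convergent; have -> : mkseq (cf_digit x) n = rev (dg x n) by rewrite revK.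
rewrite (convergent_bar pd) ?size_dg // (convergent_denq pd).1.
by rewrite /ex size_dg on alt_dg.
Qed.

End PartialSums.

(** * Cylinder sets *)

Section Cylinders.
Local Open Scope classical_set_scope.
Variable R : realType.
Local Notation mu := (@lebesgue_measure R).

Definition irr : set R := [set x | is_irrational x].

Lemma irrE : irr = ~` range (ratr : rat -> R).
Proof.
apply/seteqP; split=> x /= H; first by case=> q _ qx; apply: (H q).
by move=> q xq; apply: H; exists q.
Qed.

Lemma measurable_ratr : measurable (range (ratr : rat -> R)).
Proof.
rewrite (_ : range _ = \bigcup_(q : rat) [set ratr q : R]).
  by apply: bigcupT_measurable_rat => q.
by apply/seteqP; split=> [_ [q _ <-]|_ [q _ ->]]; exists q.
Qed.

Lemma measurable_irr : measurable irr.
Proof. by rewrite irrE; apply: measurableC; apply: measurable_ratr. Qed.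

Lemma irr_neq0 x : irr x -> x != 0.
Proof. by move=> ix; apply/eqP => x0; apply: (ix 0); rewrite rmorph0. Qed.

Lemma gaussE (x : R) : gauss x = x^-1 - (Num.floor (x^-1))%:~R. Proof. by []. Qed.

Lemma irr_gauss x : irr x -> irr (gauss x).
Proof.
move=> ix q /eqP; rewrite gaussE subr_eq => /eqP xE; apply: (ix (q + (Num.floor x^-1)%:~R)^-1).
by rewrite fmorphV rmorphD /= ratr_int -xE invrK.
Qed.

Lemma gauss_itv x : irr x -> 0 < gauss x < 1.
Proof.
move=> ix; have := irr_neq0 (irr_gauss ix); rewrite gaussE => g0.
have /andP[h1 h2] := floor_itv x^-1; rewrite lt0r g0 subr_ge0 h1 /=.
by rewrite intrD1 in h2; lra.
Qed.

Lemma irr_iter x n : irr x -> irr (iter n (@gauss R) x).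
Proof. by move=> ix; elim: n => //= n; apply: irr_gauss. Qed.

Lemma iter_itv x n : irr x -> 0 < x < 1 -> 0 < iter n (@gauss R) x < 1.
Proof. by move=> ix; case: n => //= n _; apply/gauss_itv/irr_iter. Qed.

Lemma cf_digit_gt0 x n : irr x -> 0 < x < 1 -> 0 < cf_digit x n.
Proof.
move=> ix x01; have /andP[g0 g1] := iter_itv n ix x01.
by rewrite /cf_digit floor_gt0 invf_ge1 // ltW.
Qed.

Lemma posw_dg x n : irr x -> 0 < x < 1 -> posw (dg x n).
Proof. by move=> ix x01; elim: n => // n IH; rewrite dgS /= cf_digit_gt0. Qed.

(** The window for the Gauss iterate makes induction on the word possible: removing the latest digit
    only changes the window. *)
Definition J (r : seq int) (a1 a2 : R) : set R :=
  [set x | [/\ irr x, 0 < x < 1, dg x (size r) = r & a1 < iter (size r) (@gauss R) x < a2]].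

Definition cyl r := J r 0 1.

Lemma cylP r x : cyl r x <-> [/\ irr x, 0 < x < 1 & dg x (size r) = r].
Proof. by split=> [[]|[ix x01 dE]] //; split => //; apply: iter_itv. Qed.

Lemma cyl_dg x n : irr x -> 0 < x < 1 -> cyl (dg x n) x.
Proof. by move=> ix x01; apply/cylP; rewrite size_dg. Qed.

(** If g has first digit b, then g = 1 / (b + [gauss g]), which decreases in [gauss g]; hence the
    end points are exchanged. *)
Lemma J_cons b r a1 a2 : 0 < b -> 0 <= a1 -> a1 < a2 -> a2 <= 1 ->
  J (b :: r) a1 a2 = J r (1 / (b%:~R + a2)) (1 / (b%:~R + a1)).
Proof.
move=> b0 a10 a12 a21; have bR : 0 < b%:~R :> R by rewrite ltr0z.
have b1 : 0 < b%:~R + a1 by rewrite ltr_wpDr.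
have b2 : 0 < b%:~R + a2 by rewrite ltr_wpDr // (le_trans a10 (ltW a12)).
apply/seteqP; split=> x; rewrite /J /= dgS /cf_digit.
  case=> ix x01 [fE dE]; set g := iter _ (@gauss R) x in fE *.
  rewrite gaussE fE => ga; split=> //.
  have g0 : 0 < g by have /andP[] := iter_itv (size r) ix x01.
  rewrite -/g !div1r -[g]invrK !ltf_pV2 ?posrE ?invr_gt0 //; lra.
case=> ix x01 dE; set g := iter _ (@gauss R) x => gb.
have g0 : 0 < g by have /andP[] := iter_itv (size r) ix x01.
rewrite !div1r -[g]invrK !ltf_pV2 ?posrE ?invr_gt0 // in gb.
have fE : Num.floor g^-1 = b.
  by apply/floor_def; rewrite intrD1; lra.
by split => //; rewrite ?fE ?dE //= -/g gaussE fE; lra.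
Qed.

Lemma J_nil a1 a2 : 0 <= a1 -> a2 <= 1 -> J [::] a1 a2 = irr `&` `]a1, a2[.
Proof.
move=> a10 a21; apply/seteqP; split=> x; rewrite /J /= in_itv /=; first by case.
by case=> ix xa; split => //; lra.
Qed.

Lemma J_itv r a1 a2 : posw r -> 0 <= a1 -> a1 < a2 -> a2 <= 1 ->
  J r a1 a2 = irr `&` `]Num.min (mob r a1) (mob r a2), Num.max (mob r a1) (mob r a2)[.
Proof.
elim: r a1 a2 => [|b r IH] a1 a2.
  move=> _ a10 a12 a21; rewrite J_nil //; congr (_ `&` _).
  by rewrite /mob /= min_l ?max_r // ltW.
move=> /andP[b0 pr] a10 a12 a21; rewrite J_cons //.
have bR : 1 <= b%:~R :> R by rewrite ler1z -gtz0_ge1.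
rewrite IH //; last 3 first.
- by rewrite divr_ge0 //; lra.
- by rewrite !div1r ltf_pV2 ?posrE; lra.
- by rewrite div1r invf_le1; lra.
by rewrite !mob_cons minC maxC.
Qed.

Lemma measurable_J r a1 a2 : posw r -> 0 <= a1 -> a1 < a2 -> a2 <= 1 -> measurable (J r a1 a2).
Proof. by move=> *; rewrite J_itv //; apply: measurableI => //; apply: measurable_irr. Qed.

Lemma mu_irrI (A : set R) : measurable A -> mu (irr `&` A) = mu A.
Proof.
move=> mA; apply/eqP; rewrite eq_le; apply/andP; split.
  by rewrite le_measure ?inE //; apply: measurableI => //; apply: measurable_irr.
have -> : A = (irr `&` A) `|` (~` irr `&` A) by rewrite -setIUl setUv setTI.
rewrite [X in (_ <= mu (irr `&` X))%E](_ : _ = A); last by rewrite -setIUl setUv setTI.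
have mi := measurable_irr; have mCi := measurableC mi.
rewrite (le_trans (measureU2 _ _ _)) //; try exact: measurableI.
rewrite [X in (_ + X)%E](_ : _ = 0%E) ?adde0 //.
apply/eqP; rewrite -measure_le0 -(lebesgue_measure_rat R) le_measure ?inE //.
- exact: measurableI.
- exact: measurable_ratr.
- by rewrite irrE setCK => x [].
Qed.

(** Up to the null set of rationals this is an interval between two values of a Moebius map, whose
    difference is computed by the determinant. *)
Lemma mu_J r a1 a2 : posw r -> 0 <= a1 -> a1 < a2 -> a2 <= 1 ->
  mu (J r a1 a2) = ((a2 - a1) /
   (((cq r)%:~R + a1 * (cq' r)%:~R) * ((cq r)%:~R + a2 * (cq' r)%:~R)))%:E.
Proof.
move=> pr a10 a12 a21; rewrite J_itv // mu_irrI // lebesgue_measure_itv /= lte_fin.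
have a20 : 0 <= a2 by rewrite (le_trans a10) // ltW.
have [q0 q0' qq] := cq_bounds pr.
have qR : 0 < (cq r)%:~R :> R by rewrite ltr0z.
have qR' : 0 <= (cq' r)%:~R :> R by rewrite ler0z.
set D1 := _ + a1 * _; set D2 := _ + a2 * _.
have D10 : 0 < D1 by rewrite ltr_wpDr // mulr_ge0.
have D20 : 0 < D2 by rewrite ltr_wpDr // mulr_ge0.
have dE : mob r a2 - mob r a1 = (-1) ^+ size r * ((a2 - a1) / (D1 * D2)).
  rewrite !mobE // -/D1 -/D2.
  have := cont_det r => /(congr1 (fun z : int => z%:~R : R)).
  rewrite rmorphB !rmorphM rmorphXn rmorphN1 /= => <-.
  rewrite /D1 /D2; field; rewrite -/D1 -/D2 !gt_eqF //.
set e := _ / _ in dE *; have e0 : 0 < e by rewrite divr_gt0 ?mulr_gt0 // subr_gt0.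
have [a1E|a1E] : mob r a2 = mob r a1 + e \/ mob r a1 = mob r a2 + e.
  move/eqP: dE; rewrite subr_eq -signr_odd; case: odd; rewrite ?expr1 ?expr0 ?mul1r ?mulN1r => /eqP ->.
    by right; rewrite addrAC addNr add0r.
  by left; rewrite addrC.
- rewrite a1E min_l ?max_r ?lerDl ?ltW // ltrDl e0 -EFinD; congr EFin; ring.
- rewrite a1E min_r ?max_l ?lerDl ?ltW // ltrDl e0 -EFinD; congr EFin; ring.
Qed.

Lemma mu_cyl r : posw r -> mu (cyl r) = (1 / ((cq r)%:~R * ((cq r)%:~R + (cq' r)%:~R)))%:E.
Proof. by move=> pr; rewrite mu_J // subr0 mul0r addr0 // !mul1r. Qed.

Lemma measurable_cyl r : posw r -> measurable (cyl r).
Proof. by move=> pr; apply: measurable_J. Qed.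

(** There are countably many words, so the set is a countable union of cylinders. *)
Lemma measurable_dg (Q : seq int -> Prop) n :
  measurable [set x : R | [/\ irr x, 0 < x < 1 & Q (dg x n)]].
Proof.
rewrite (_ : mkset _ = \bigcup_(r : seq int)
   (if `[< Q r /\ size r = n /\ posw r >] then cyl r else set0)).
  apply: countable_bigcupT_measurable => // r; case: asboolP => // -[_ [_ pr]].
  exact: measurable_cyl.
apply/seteqP; split=> x /=.
  case=> ix x01 Qx; exists (dg x n) => //.
  have -> : `[< Q (dg x n) /\ size (dg x n) = n /\ posw (dg x n) >] = true.
    by apply/asboolP; rewrite size_dg posw_dg.
  exact: cyl_dg.
case=> r _; case: asboolP => // -[Qr [sr _]] /cylP[ix x01 dE]; split => //.
by rewrite -sr dE.
Qed.

Lemma cyl_cons b r : cyl (b :: r) `<=` cyl r.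
Proof. by move=> x /cylP[ix x01] /=; rewrite dgS => -[_ dE]; apply/cylP. Qed.

Lemma cyl_split r : posw r -> cyl r = \bigcup_n cyl (Posz n.+1 :: r).
Proof.
move=> pr; apply/seteqP; split=> [x /cylP[ix x01 dE]|x [n _]]; last exact: cyl_cons.
have b0 := cf_digit_gt0 (size r) ix x01; exists (`|cf_digit x (size r)|.-1)%N => //.
apply/cylP; split => //=; rewrite dgS dE; congr cons; lia.
Qed.

Lemma trivIset_cyl r : trivIset setT (fun n => cyl (Posz n.+1 :: r)).
Proof.
apply/trivIsetP => i j _ _ ij; apply/seteqP; split=> x //= [/cylP[_ _ + ] /cylP[_ _]].
by rewrite /= !dgS => -[-> _] [[]] /eqP; rewrite (negbTE ij).
Qed.

(** [cf_digit x n] is the digit of index n + 1. The 1 is added because b + 1 bounds the reciprocal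
    of the argument of h, up to sign, in the term of the digit b. *)
Definition bigd r n (X : R) : set R := [set x | cyl r x /\ X < (cf_digit x n)%:~R + 1].

Lemma measurable_bigd r n X : posw r -> measurable (bigd r n X).
Proof.
move=> pr; rewrite (_ : bigd r n X = cyl r `&` [set x | [/\ irr x, 0 < x < 1 &
   (fun s => X < (head 0 s)%:~R + 1) (dg x n.+1)]]).
  apply: measurableI; [exact: measurable_cyl |].
  exact: (measurable_dg (fun s => is_true (X < (head 0 s)%:~R + 1))).
apply/seteqP; split=> x /=; rewrite dgS /=; last by case=> cx [_ _ ?]; split.
by move=> [cx Xx]; split=> //; move/cylP: cx => [].
Qed.

Lemma mu_bigd_next r X : posw r -> 0 < X ->
  (mu (bigd r (size r) X) <= (4 / X)%:E * mu (cyl r))%E.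
Proof.
move=> pr X0; have [q0 q0' qq] := cq_bounds pr; have mN := measurable_bigd (size r) X pr.
have mc := measurable_cyl pr.
have qR : 0 < (cq r)%:~R :> R by rewrite ltr0z.
have qR' : 0 <= (cq' r)%:~R :> R by rewrite ler0z.
have qqR : (cq' r)%:~R <= (cq r)%:~R :> R by rewrite ler_int.
have [X2|X2] := leP X 2.
  apply: (@le_trans _ _ (mu (cyl r))); first by rewrite le_measure ?inE // => x [].
  rewrite -[leLHS]mul1e lee_wpmul2r // lee_fin ler_pdivlMr //; lra.
have X1 : 2 / X <= 1 by rewrite ler_pdivrMr // mul1r ltW.
have X20 : 0 < 2 / X by rewrite divr_gt0.
(* A digit b with b + 1 > X > 2 forces the Gauss iterate below 1 / (X - 1), hence below 2 / X. *)
apply: (@le_trans _ _ (mu (J r 0 (2 / X)))).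
  rewrite le_measure ?inE //; first exact: measurable_J.
  move=> x [/cylP[ix x01 dE] Xx]; split => //.
  have /andP[g0 g1] := iter_itv (size r) ix x01; rewrite g0 /=.
  set g := iter _ _ _ in g0 g1 *.
  have := floor_le_tmp g^-1; rewrite -/(cf_digit x (size r)) => bg.
  rewrite -[g]invrK -[2 / X]invrK ltf_pV2 ?posrE ?invr_gt0 // invf_div.
  have : X / 2 = X - X / 2 by field.
  lra.
rewrite mu_J // mu_cyl // -EFinM lee_fin subr0 mul0r addr0.
set q := (cq r)%:~R in qR qqR *; set q' := (cq' r)%:~R in qR' qqR *.
have D1 : 0 < q + q' by rewrite ltr_wpDr.
have D2 : 0 <= 2 / X * q' by rewrite mulr_ge0 // ltW.
rewrite ler_pdivrMr; last by rewrite mulr_gt0 // ltr_wpDr.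
have -> : 4 / X * (1 / (q * (q + q'))) * (q * (q + 2 / X * q')) =
   (2 / X) * (2 * (q + 2 / X * q') / (q + q')).
  by field; rewrite !gt_eqF.
by rewrite ler_pMr // ler_pdivlMr // mul1r; lra.
Qed.

(** The factor 4 / X does not depend on the word, so the estimate for the next digit passes to
    deeper digits by splitting into child cylinders and summing. *)
Lemma mu_bigd n r X : posw r -> 0 < X -> (size r <= n)%N ->
  (mu (bigd r n X) <= (4 / X)%:E * mu (cyl r))%E.
Proof.
move=> + X0; move dE : (n - size r)%N => d; elim: d r dE => [|d IH] r dE pr rn.
  have -> : n = size r by lia.
  exact: mu_bigd_next.
have pr' i : posw (Posz i.+1 :: r) by rewrite /= pr.
apply: (@le_trans _ _ (\sum_(i <oo) mu (bigd (Posz i.+1 :: r) n X))%E).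
  apply: measure_sigma_subadditive => [i||]; [exact: measurable_bigd|exact: measurable_bigd|].
  by move=> x [cx Xx]; move: cx; rewrite (cyl_split pr) => -[i _ ci]; exists i.
rewrite (cyl_split pr) measure_bigcup //; last 2 first.
  by move=> i _; exact: measurable_cyl.
  exact: trivIset_cyl.
rewrite [Y in (_ <= _ * Y)%E](@eq_eseriesl _ _ xpredT); last by move=> i; rewrite in_setT.
rewrite -nneseriesZl; last by move=> i _; exact: measure_ge0.
by apply: lee_nneseries => // i _; apply: IH => //=; lia.
Qed.

End Cylinders.

(** * Density points and long cylinders *)

Section Density.
Local Open Scope classical_set_scope.
Variable R : realType.
Local Notation mu := (@lebesgue_measure R).
Implicit Types x y : R.

Lemma cyl_diam r x y : posw r -> cyl r x -> cyl r y ->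
  `|x - y| < 1 / ((cq r)%:~R * ((cq r)%:~R + (cq' r)%:~R)).
Proof.
move=> pr; have := mu_cyl R pr; rewrite /cyl J_itv // mu_irrI // lebesgue_measure_itv /= lte_fin.
set a := Num.min _ _; set b := Num.max _ _.
move=> muE [_] /=; rewrite in_itv /= => /andP[ax xb] [_] /=; rewrite in_itv /= => /andP[ay yb].
rewrite (lt_trans ax xb) -EFinD in muE; case: muE => <-.
by rewrite ltr_norml; lra.
Qed.

Lemma ge_cq_dg x n : irr x -> 0 < x < 1 -> n%:R <= 2 * (cq (dg x n))%:~R ^+ 2 :> R.
Proof.
move=> ix x01; have pd := posw_dg n ix x01.
have := @cq_growth (dg x n) [::]; rewrite cats0 => /(_ pd).
rewrite size_dg -[cq [::]]/1 expr1n mulr1 => H.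
have H2 : (Posz n) <= 2 * cq (dg x n) ^+ 2.
  apply: le_trans H; rewrite -[2]/(Posz 2) -rmorphXn /= lez_nat ltnW // ltn_expl //.
by move: H2; rewrite -(ler_int R) rmorphM rmorphXn.
Qed.

Lemma cyl_cat (l r : seq int) : @cyl R (l ++ r) `<=` cyl r.
Proof. by elim: l => //= b l IH; apply: subset_trans IH; apply: cyl_cons. Qed.

(** The cylinder of [W ++ dg x0 n] lies in the ball around [x0] whose radius is the length of the
    cylinder of [dg x0 n], and fills a fraction of it bounded below in terms of [M]. Near a density
    point the complement of [A] is too thin to contain half of it. *)
Lemma density_words (A : set R) : measurable A -> mu A != 0%E ->
    (forall x, A x -> irr x /\ 0 < x < 1) ->
  exists2 x0, A x0 & forall M : nat, exists n0, forall n, (n0 <= n)%N ->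
    forall W, posw W -> (size W <= M)%N -> all (fun b => b <= Posz M) W ->
    forall B, measurable B -> B `<=` cyl (W ++ dg x0 n) ->
      ((2^-1)%:E * mu (cyl (W ++ dg x0 n)) <= mu B)%E -> exists2 x, A x & B x.
Proof.
move=> mA A0 Airr.
(* By Lebesgue's density theorem, [A] would be null if none of its points were a density point. *)
have [x0 Ax0 dx0] : exists2 x0, A x0 &
   (mu (A `&` ball x0 r) * (mu (ball x0 r))^-1)%E @[r --> 0^'+] --> (\1_A x0)%:E.
  apply: contrapT => H; move/negP: A0; apply; apply/eqP; apply: measure_negligible => //.
  apply: negligibleS (lebesgue_density mA) => x Ax /= dx; apply: H; by exists x.
exists x0 => // M; have [ix0 x001] := Airr _ Ax0.
(* With Q <= (M + 1)^M q this gives 2 e / q^2 <= 1 / (4 Q^2), which is at most half the measure of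
   the small cylinder. *)
pose e : R := 1 / (8 * (M.+1)%:R ^+ (2 * M)).
have e0 : 0 < e by rewrite divr_gt0 // mulr_gt0 // exprn_gt0.
have [rho rho0 Hrho] : exists2 rho : R, 0 < rho & forall r, 0 < r < rho ->
    (mu (ball x0 r `\` A) < (e * (2 * r))%:E)%E.
  move: dx0; rewrite indicE mem_set // => /fine_cvgP[] _ /cvgrPdist_lt /(_ _ e0).
  case=> rho /= rho0 H; exists rho => // r /andP[r0 rr].
  have := H r; rewrite /= sub0r normrN gtr0_norm // => /(_ rr r0).
  have mb : measurable (ball x0 r) by rewrite ball_itv; exact: measurable_itv.
  have bE : mu (ball x0 r) = (2 * r)%:E.
    by rewrite lebesgue_measure_ball ?ltW // mulr_natl.
  have abE : mu (A `&` ball x0 r) = (fine (mu (A `&` ball x0 r)))%:E.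
    rewrite fineK // ge0_fin_numE //; apply: (@le_lt_trans _ _ (mu (ball x0 r))).
      by rewrite le_measure ?inE //; exact: measurableI.
    by rewrite bE ltry.
  have : mu (ball x0 r) = (mu (ball x0 r `\` A) + mu (A `&` ball x0 r))%E.
    by rewrite [A `&` _]setIC; exact: measureDI.
  rewrite abE bE.
  have r20 : 2 * r != 0 by rewrite mulf_neq0 // gt_eqF.
  rewrite inver (negbTE r20) -EFinM /=; move: (fine _) => al.
  case: (mu (ball x0 r `\` A)) => // c /=; rewrite -EFinD => -[cE].
  rewrite ltr_norml => /andP[_ ]; rewrite lte_fin ltrBlDl -ltrBlDr ltr_pdivlMr ?mulr_gt0 //.
  by rewrite mulrBl mul1r; lra.
(* This threshold yields 1 / q^2 <= 2 / n < rho for the radius of the ball. *)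
exists (Num.truncn (2 / rho)).+1 => n nn W pW sW bW B mB BW muB.
apply: contrapT => H.
have pd := posw_dg n ix0 x001.
have pWd : posw (W ++ dg x0 n) by rewrite all_cat pW.
have mc := @measurable_cyl R _ pWd.
have [q0 q0' qq] := cq_bounds pd; have [Q0 Q0' QQ] := cq_bounds pWd.
set q := (cq (dg x0 n))%:~R : R.
have q0R : 0 < q by rewrite ltr0z.
set Q := (cq (W ++ dg x0 n))%:~R : R.
have Q0R : 0 < Q by rewrite ltr0z.
have QqR : Q <= (M.+1)%:R ^+ M * q.
  have M1 : (0 < M)%N \/ W = [::] by case: (M) sW => [|?]; [case: (W); [right|]|left].
  have h1 : cq (W ++ dg x0 n) <= (Posz M + 1) ^+ M * cq (dg x0 n).
    case: M1 => [M1|->]; last by apply: ler_peMl; [exact: ltW|rewrite exprn_ege1 // lerDr].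
    apply: le_trans (cq_upper _ pWd bW) _ => //.
    by rewrite ler_pM2r // ler_weXn2l // lerDr.
  move: h1; rewrite -(ler_int R) rmorphM rmorphXn rmorphD /= -/Q -/q.
  by rewrite -natr1.
pose rn := 1 / (q * (q + (cq' (dg x0 n))%:~R)).
have rn0 : 0 < rn by rewrite divr_gt0 // mulr_gt0 // ltr_wpDr // ler0z.
have rnq : rn <= 1 / q ^+ 2.
  rewrite /rn !div1r lef_pV2 ?posrE ?exprn_gt0 ?mulr_gt0 ?ltr_wpDr ?ler0z //.
  by rewrite expr2 ler_pM2l // lerDl ler0z.
have rnrho : rn < rho.
  apply: le_lt_trans rnq _; rewrite ltr_pdivrMr ?exprn_gt0 // -ltr_pdivrMl // mulr1.
  have h1 := ge_cq_dg n ix0 x001.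
  have h2 : 2 / rho < n%:R.
    by apply: lt_le_trans (truncnS_gt _) _; rewrite ler_nat.
  by rewrite -/q in h1; lra.
have := Hrho rn; rewrite rn0 rnrho => /(_ isT); apply/negP; rewrite -leNgt.
apply: (@le_trans _ _ (mu B)); last first.
  rewrite le_measure ?inE //; first by apply: measurableD => //; rewrite ball_itv; exact: measurable_itv.
  move=> x Bx; split; last by move=> Ax; apply: H; exists x.
  have cx := cyl_cat (BW _ Bx).
  rewrite -ball_normE /=; apply: cyl_diam => //; exact: cyl_dg.
apply: le_trans muB; rewrite mu_cyl // -EFinM lee_fin -/Q.
apply: (@le_trans _ _ (1 / (4 * Q ^+ 2))).
  apply: (@le_trans _ _ (2 * e / q ^+ 2)).
    by rewrite mulrCA mulrA ler_pM2l ?mulr_gt0 // -div1r.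
  rewrite /e; set w := (M.+1)%:R ^+ (2 * M).
  have w0 : 0 < w by rewrite exprn_gt0.
  have Q2 : Q ^+ 2 <= w * q ^+ 2.
    rewrite /w mulnC exprM -exprMn; apply: lerXn2r => //; rewrite nnegrE ltW //.
    by rewrite mulr_gt0 // exprn_gt0.
  have -> : 2 * (1 / (8 * w)) / q ^+ 2 = 1 / (4 * (w * q ^+ 2)).
    by field; rewrite !gt_eqF.
  by rewrite !div1r lef_pV2 ?posrE ?mulr_gt0 ?exprn_gt0 // ler_pM2l.
rewrite !div1r -invfM lef_pV2 ?posrE ?mulr_gt0 ?exprn_gt0 ?ltr_wpDr ?ler0z //.
have : (cq' (W ++ dg x0 n))%:~R <= Q by rewrite ler_int.
rewrite expr2; nra.
Qed.

End Density.

(** * Tails of the series at typical points *)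

Section Tails.
Local Open Scope classical_set_scope.
Variable R : realType.
Local Notation mu := (@lebesgue_measure R).
Variables (a dl : R).
Hypotheses (a0 : 0 < a) (dl0 : 0 < dl < 1).
Let s := (1 - dl)^-1.
Let sg := s - 1.

Let dl1 : 0 < 1 - dl. Proof. by case/andP: dl0 => ?; rewrite subr_gt0. Qed.

Let sg0 : 0 < sg.
Proof. by rewrite subr_gt0 invf_gt1 // gtrBl; case/andP: dl0. Qed.

(** A digit b up to this threshold satisfies b^(1-dl) <= a (j + 1) + D, a linear growth which the
    decay of q^(-Re k) absorbs. The exponent exceeds 1, so the reciprocals are summable. *)
Definition thr (D : R) (j : nat) : R := (a * j.+1%:R + D) `^ (1 - dl)^-1.

Definition bad r D : set R := \bigcup_j bigd r (size r + j) (thr D j).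

(** This compares y^(-s) at the right end with its integral over [x, x + a]; the inequality expR z
    >= 1 + z replaces integration. *)
Lemma powR_step (x : R) : 0 < x ->
  a * (x + a) `^ (- s) <= (x `^ (- sg) - (x + a) `^ (- sg)) / sg.
Proof.
move=> x0; have xa0 : 0 < x + a by rewrite addr_gt0.
rewrite ler_pdivlMr //.
have h1 : a / (x + a) <= ln (x + a) - ln x.
  rewrite -ln_div ?posrE // -[_ / x]invrK lnV ?posrE ?invr_gt0 ?divr_gt0 // invf_div.
  rewrite lerNr; have -> : - (a / (x + a)) = x / (x + a) - 1.
    by field; rewrite gt_eqF.
  have := expR_ge1Dx (ln (x / (x + a))); rewrite lnK ?posrE ?divr_gt0 //; lra.
have h2 : x `^ (- sg) = (x + a) `^ (- sg) * expR (sg * (ln (x + a) - ln x)).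
  rewrite /powR !gt_eqF // -expRD; congr expR; ring.
have h3 : (x + a) `^ (- s) = (x + a) `^ (- sg) / (x + a).
  have -> : - s = - sg + (-1) by rewrite /sg; ring.
  rewrite powRD; last by rewrite (lt0r_neq0 xa0) implybT.
  by rewrite powR_inv1 // ltW.
rewrite h2 h3; set w := _ `^ _; have w0 : 0 < w by rewrite powR_gt0.
have h4 := expR_ge1Dx (sg * (ln (x + a) - ln x)).
have h5 : sg * (a / (x + a)) <= sg * (ln (x + a) - ln x) by rewrite ler_pM2l.
have -> : a * (w / (x + a)) * sg = w * (sg * (a / (x + a))) by ring.
rewrite -[X in _ <= _ - X]mulr1 -mulrBr ler_pM2l //; lra.
Qed.

Lemma thrV_sum (D : R) n : 0 < D ->
  \sum_(0 <= j < n) (4 / thr D j) <= 4 * (D `^ (- sg) / (a * sg)).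
Proof.
move=> D0.
suff H : \sum_(0 <= j < n) (4 / thr D j) <=
    4 * ((D `^ (- sg) - (a * n%:R + D) `^ (- sg)) / (a * sg)).
  apply: le_trans H _; rewrite ler_pM2l // ler_pM2r ?invr_gt0 ?mulr_gt0 //.
  by rewrite gerBl powR_ge0.
elim: n => [|n IH]; first by rewrite big_geq // mulr0 add0r subrr mul0r mulr0.
rewrite big_nat_recr //=; apply: le_trans (lerD IH (lexx _)) _.
have x0 : 0 < a * n%:R + D by rewrite ltr_wpDl // mulr_ge0 // ltW.
have := powR_step x0; have -> : a * n%:R + D + a = a * n.+1%:R + D by rewrite -natr1; ring.
rewrite /thr -/s powRN; set p := _^-1; set u := _ `^ _; set v := _ `^ _; set z := D `^ _ => H.
have H2 : p <= (u - v) / (a * sg).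
  by rewrite [a * sg]mulrC invfM mulrA ler_pdivlMr // mulrC.
have -> : 4 * ((z - v) / (a * sg)) = 4 * ((z - u) / (a * sg)) + 4 * ((u - v) / (a * sg)) by ring.
by rewrite lerD2l ler_pM2l.
Qed.

Lemma thr_gt0 D j : 0 < D -> 0 < thr D j.
Proof. by move=> D0; rewrite powR_gt0 // ltr_wpDl // mulr_ge0 // ltW. Qed.

Lemma measurable_bad r D : posw r -> measurable (bad r D).
Proof. by move=> pr; apply: bigcupT_measurable => j; exact: measurable_bigd. Qed.

Lemma mu_bad r D : posw r -> 0 < D ->
  (mu (bad r D) <= (4 * (D `^ (- sg) / (a * sg)))%:E * mu (cyl r))%E.
Proof.
move=> pr D0.
apply: (@le_trans _ _ (\sum_(j <oo) mu (bigd r (size r + j) (thr D j)))%E).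
  apply: measure_sigma_subadditive => [j||]; [exact: measurable_bigd|exact: measurable_bad|].
  by [].
apply: (@le_trans _ _ (\sum_(j <oo) (4 / thr D j)%:E * mu (cyl r))%E).
  apply: lee_nneseries => // j _; apply: mu_bigd => //; first exact: thr_gt0.
  by rewrite leq_addr.
apply: lime_le.
  by apply: is_cvg_nneseries => j _ _; rewrite mule_ge0 // lee_fin divr_ge0 // ltW // thr_gt0.
apply: nearW => n; rewrite mu_cyl // -EFinM.
under eq_bigr do rewrite -EFinM.
rewrite sumEFin lee_fin -mulr_suml ler_wpM2r //; last exact: thrV_sum.
have [q0 q0' _] := cq_bounds pr.
by rewrite divr_ge0 // mulr_ge0 ?addr_ge0 ?ler0z // ltW.
Qed.

Lemma bad_small (e : R) : 0 < e -> exists2 D, 0 < D & 4 * (D `^ (- sg) / (a * sg)) <= e.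
Proof.
move=> e0; have asg : 0 < a * sg by rewrite mulr_gt0.
have w0 : 0 < e * (a * sg) / 4 by rewrite divr_gt0 // mulr_gt0.
(* The witness turns the required inequality into an equality. *)
exists ((e * (a * sg) / 4) `^ (- sg^-1)); first by rewrite powR_gt0.
rewrite -powRrM mulrNN mulVf ?gt_eqF // powRr1; last exact: ltW.
by rewrite le_eqVlt; apply/orP; left; apply/eqP; field; rewrite !gt_eqF.
Qed.

Lemma thr_exp D j (b : R) : 0 < D -> 0 <= b -> b <= thr D j ->
  b `^ (1 - dl) <= a * j.+1%:R + D.
Proof.
move=> D0 b0 bj; have x0 : 0 <= a * j.+1%:R + D by rewrite addr_ge0 ?mulr_ge0 // ltW.
have -> : a * j.+1%:R + D = thr D j `^ (1 - dl).
  by rewrite /thr -powRrM mulVf ?lt0r_neq0 // powRr1.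
by apply: (ge0_ler_powR (ltW dl1)); rewrite ?nnegrE ?powR_ge0.
Qed.

End Tails.

(** * Convergence of the series almost everywhere *)

Section Convergence.
Local Open Scope classical_set_scope.
Variables (R : realType) (k th : R[i]) (f : rat -> R[i]) (h : R -> R[i]).
Local Notation mu := (@lebesgue_measure R).
Hypothesis k_gt0 : 0 < complex.Re k.
Hypothesis th_root : exists n : nat, (0 < n)%N /\ th ^+ n = 1.
Hypothesis f_shift : forall x : rat, f (x + 1) = th * f x.
Hypothesis h_pos : forall x : rat, 0 < x ->
  h (ratr x) = f x - th ^ 3%:Z * cpow (ratr `|x|) (- k) * f (- x^-1).
Hypothesis h_neg : forall x : rat, x < 0 ->
  h (ratr x) = f x - th ^ (- 3)%Z * cpow (ratr `|x|) (- k) * f (- x^-1).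
Variables (dl C : R).
Hypothesis dl0 : 0 < dl < 1.
Hypothesis h_bound : forall x : R, 0 < `|x| <= 1 -> cabs (h x) <= C * expR (`|x| `^ (-1 + dl)).

(** Denominators gain a factor 2^(1/2) per digit, so q^(-Re k) decays like exp(-2 a j); the growth
    of h may use up exp(a j), and exp(-a j) remains. *)
Definition tail_rate : R := complex.Re k * ln 2 / 4.
Local Notation a := tail_rate.

Definition qk (r : seq int) : R := expR (- complex.Re k * ln (cq r)%:~R).

Lemma qkE r : qk r = expR (- complex.Re k * ln (cq r)%:~R). Proof. by []. Qed.

Lemma tail_rate_gt0 : 0 < a.
Proof. by rewrite divr_gt0 // mulr_gt0 // ln_gt0 // ltr1n. Qed.

Lemma C_ge0 : 0 <= C.
Proof.
have := @h_bound 1; rewrite normr1 ltr01 lexx => /(_ isT) /(le_trans (cabs_ge0 _)).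
by rewrite pmulr_lge0 // expR_gt0.
Qed.

Lemma qk_growth l r : posw (l ++ r) -> (0 < size l)%N ->
  qk (l ++ r) <= qk r * expR (- (2 * a * (size l).-1%:R)).
Proof.
move=> pl sl; rewrite /qk -expRD ler_expR.
have pr : posw r by move: pl; rewrite all_cat => /andP[].
have q0 : 0 < (cq r)%:~R :> R by rewrite ltr0z cq_gt0.
have Q0 : 0 < (cq (l ++ r))%:~R :> R by rewrite ltr0z cq_gt0.
have H : 2 ^+ (size l).-1 * (cq r)%:~R ^+ 2 <= (cq (l ++ r))%:~R ^+ 2 :> R.
  have := cq_growth pl; rewrite -[size l]prednK // exprS -mulrA ler_pM2l //.
  by rewrite -(ler_int R) rmorphM !rmorphXn.
have {}H : (size l).-1%:R * ln 2 + 2 * ln (cq r)%:~R <= 2 * ln (cq (l ++ r))%:~R :> R.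
  move: H; rewrite -ler_ln ?posrE ?mulr_gt0 ?exprn_gt0 // lnM ?posrE ?exprn_gt0 // !lnXn //.
  by rewrite !mulr_natl.
rewrite /a; have := k_gt0; set K := complex.Re k; set A := ln _ in H *; set B := ln _ in H *.
move=> K0.
have := ler_wpM2l (ltW K0) H; lra.
Qed.

Lemma trm_tail_bound (x : R) m D j : irr x -> 0 < x < 1 -> 0 < D ->
    (cf_digit x (m + j))%:~R + 1 <= thr a dl D j ->
  cabs (trm k th h (dg x (m + j).+1)) <=
    C * expR (a + D) * qk (dg x m) * expR (- a) ^+ j.
Proof.
move=> ix x01 D0 bj; set r := dg x (m + j).+1.
have pr : posw r := posw_dg _ ix x01.
have [l rl sl] : exists2 l, r = l ++ dg x m & size l = j.+1.
  rewrite /r -addnS; elim: (j.+1) => [|i [l lE sl]]; first by exists [::]; rewrite ?addn0.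
  by exists (cf_digit x (m + i) :: l); rewrite ?addnS ?dgS ?lE //= sl.
have rE : r = cf_digit x (m + j) :: dg x (m + j) by rewrite /r dgS.
set b := cf_digit x (m + j) in bj rE; set t := dg x (m + j) in rE.
have pt : posw t := posw_dg _ ix x01.
have b0 : 0 < b by exact: cf_digit_gt0.
have bR : 0 < b%:~R :> R by rewrite ltr0z.
have /andP[y0 y1] := cy_bounds pt.
have y0R : 0 <= ratr (cy t) :> R by rewrite ler0q.
have y1R : ratr (cy t) <= 1 :> R by rewrite -[1](rmorph1 (ratr : rat -> R)) ler_rat.
rewrite cabs_trm // -/(qk r).
have hb : cabs (h ((-1) ^+ (size r).+1 * ratr (cy r))) <= C * expR (a * j.+1%:R + D).
  have yE : ratr (cy r) = (b%:~R + ratr (cy t))^-1 :> R.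
    by rewrite rE cy_cons div1r fmorphV rmorphD /= ratr_int.
  have by0 : 0 < b%:~R + ratr (cy t) :> R by rewrite ltr_wpDr.
  have b1 : 1 <= b%:~R :> R by rewrite ler1z -gtz0_ge1.
  have nE : `|(-1) ^+ (size r).+1 * ratr (cy r)| = (b%:~R + ratr (cy t))^-1 :> R.
    by rewrite normrMsign yE gtr0_norm // invr_gt0.
  apply: le_trans (h_bound _) _; rewrite nE.
    by rewrite invr_gt0 by0 invf_le1 //; lra.
  rewrite ler_wpM2l ?C_ge0 // ler_expR.
  have -> : (b%:~R + ratr (cy t))^-1 `^ (-1 + dl) = (b%:~R + ratr (cy t)) `^ (1 - dl).
    by rewrite -powR_inv1 ?ltW // -powRrM; congr (_ `^ _); ring.
  apply: (thr_exp tail_rate_gt0 dl0 D0); first exact: ltW.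
  by apply: le_trans bj; rewrite lerD2l.
have qb : qk r <= qk (dg x m) * expR (- (2 * a * j%:R)).
  by have := @qk_growth l (dg x m); rewrite -rl sl => /(_ pr isT).
apply: le_trans (ler_pM _ _ qb hb) _; rewrite ?expR_ge0 ?cabs_ge0 //.
rewrite le_eqVlt; apply/orP; left; apply/eqP.
rewrite -expRM_natl; set q := qk _.
have -> : q * expR (- (2 * a * j%:R)) * (C * expR (a * j.+1%:R + D)) =
   C * q * (expR (- (2 * a * j%:R)) * expR (a * j.+1%:R + D)) by ring.
rewrite -expRD.
have -> : C * expR (a + D) * q * expR (j%:R * - a) = C * q * (expR (a + D) * expR (j%:R * - a)) by ring.
rewrite -expRD; congr (_ * expR _); rewrite -natr1; ring.
Qed.

Definition tail_const (D : R) : R := C * expR (a + D) / (1 - expR (- a)).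

(** Outside the bad set every digit beyond depth m is below its threshold, so the partial sums
    converge at a geometric rate. *)
Lemma fstar_good x m D : 0 < D -> cyl (dg x m) x -> ~ bad a dl (dg x m) D x ->
  exists2 l, fstar_is th k f x l &
    cabs (psum k th f h (dg x m) - l) <= tail_const D * qk (dg x m).
Proof.
move=> D0 cx nb; have /cylP[ix x01 _] := cx.
have good j : (cf_digit x (m + j))%:~R + 1 <= thr a dl D j.
  rewrite leNgt; apply/negP => H; apply: nb; exists j => //; split => //.
  by rewrite size_dg.
pose u j := psum k th f h (dg x (m + j)).
have ea : 0 < expR (- a) < 1 by rewrite expR_gt0 expR_lt1 oppr_lt0 tail_rate_gt0.
have K0 : 0 <= C * expR (a + D) * qk (dg x m) by rewrite !mulr_ge0 ?C_ge0 ?expR_ge0.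
have Hu n : cabs (u n.+1 - u n) <= C * expR (a + D) * qk (dg x m) * expR (- a) ^+ n.
  rewrite /u addnS dgS /= addrC addKr -dgS; exact: trm_tail_bound.
have [l cl bl] := geometric_cvg K0 ea Hu; exists l.
  (* f-star uses the lengths 2 j + 1, the series here the lengths m + i; j >= N + m ensures i >=
     N. *)
  split=> //; split => // e /cl[N HN]; exists (N + m)%N => j jN.
  rewrite (fstar_term_psum th_root f_shift h_pos h_neg) ?posw_dg //.
  have jE : (2 * j + 1)%N = (m + (2 * j + 1 - m))%N by lia.
  rewrite jE; apply: HN; lia.
have := bl 0%N; rewrite /u addn0 expr0 mulr1 => /le_trans; apply.
by rewrite /tail_const le_eqVlt; apply/orP; left; apply/eqP; ring.
Qed.

Lemma fstar_ae : {ae mu, forall x, 0 < x < 1 -> exists l, fstar_is th k f x l}.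
Proof.
have a0 := tail_rate_gt0.
have /choice[D HD] : forall n : nat, exists D : R, 0 < D /\
    4 * (D `^ (- ((1 - dl)^-1 - 1)) / (a * ((1 - dl)^-1 - 1))) <= n.+1%:R^-1.
  move=> n; have [|D D0 De] := @bad_small R a dl a0 dl0 n.+1%:R^-1; last by exists D.
  by rewrite invr_gt0.
(* These bad sets have measure at most 1 / (n + 1), so [B] is null, and a point outside [B] escapes
   one of them. *)
pose B := \bigcap_n bad a dl [::] (D n).
have mb E : measurable (bad a dl [::] E) := @measurable_bad R a dl [::] E isT.
have mB : measurable B by apply: bigcapT_measurable => n; exact: mb.
have B0 : mu B = 0%E.
  apply/eqP; rewrite eq_le measure_ge0 andbT; apply/lee_addgt0Pr => e e0; rewrite add0e.
  pose n := Num.truncn e^-1; have [Dn0 Dne] := HD n.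
  apply: (@le_trans _ _ (mu (bad a dl [::] (D n)))).
    by apply: le_measure; [rewrite inE|rewrite inE; exact: mb|move=> x Bx; exact: Bx].
  apply: le_trans (mu_bad a0 dl0 (isT : posw [::]) Dn0) _.
  rewrite mu_cyl // -EFinM lee_fin /cq /cq' /= addr0 mulr1 divr1 mulr1.
  apply: le_trans Dne _; rewrite -[e]invrK lef_pV2 ?posrE ?invr_gt0 // ltW //.
  exact: truncnS_gt.
exists (range (ratr : rat -> R) `|` B); split.
- by apply: measurableU => //; exact: measurable_ratr.
- by rewrite measureU0 //; [exact: lebesgue_measure_rat|exact: measurable_ratr].
move=> x /= H; apply: contrapT => /not_orP[nr nB]; apply: H => x01.
have ix : irr x by rewrite irrE.
have [n nb] : exists n, ~ bad a dl [::] (D n) x.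
  by apply: contrapT => /forallNP nb; apply: nB => n _; apply: contrapT; apply: nb.
have [l Hl _] := @fstar_good x 0 (D n) (HD n).1 (cyl_dg 0 ix x01) nb.
by exists l.
Qed.

End Convergence.

(** * Level sets of phi f-star, continuity of the law, and the estimate near an atom *)

Section Law.
Local Open Scope classical_set_scope.
Variables (R : realType) (k th : R[i]) (f : rat -> R[i]) (h : R -> R[i]) (phi : R[i] -> R).
Local Notation mu := (@lebesgue_measure R).
Hypothesis k_gt0 : 0 < complex.Re k.
Hypothesis th_root : exists n : nat, (0 < n)%N /\ th ^+ n = 1.
Hypothesis f_shift : forall x : rat, f (x + 1) = th * f x.
Hypothesis h_pos : forall x : rat, 0 < x ->
  h (ratr x) = f x - th ^ 3%:Z * cpow (ratr `|x|) (- k) * f (- x^-1).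
Hypothesis h_neg : forall x : rat, x < 0 ->
  h (ratr x) = f x - th ^ (- 3)%Z * cpow (ratr `|x|) (- k) * f (- x^-1).
Hypothesis phi_lin :
  forall (r : R) (z w : R[i]), phi ((r%:C)%C * z + w) = r * phi z + phi w.

Local Notation psum := (psum k th f h).
Local Notation qk := (qk k).

Lemma inv_truncn (e : R) : 0 < e -> (Num.truncn e^-1).+1%:R^-1 < e.
Proof.
by move=> e0; rewrite -[ltRHS]invrK ltf_pV2 ?posrE ?invr_gt0 // truncnS_gt.
Qed.

Lemma le_mu (A B : set R) : measurable A -> measurable B -> A `<=` B -> (mu A <= mu B)%E.
Proof. by move=> mA mB AB; apply: le_measure; rewrite ?inE. Qed.

Definition fset (Q : R -> Prop) : set R := [set x | exists l, fstar_is th k f x l /\ Q (phi l)].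

Lemma fstar_isP x l : fstar_is th k f x l <->
  [/\ irr x, 0 < x < 1 & ccvg_to (fun j => psum (dg x (2 * j + 1))) l].
Proof.
split=> [[x01 [ix cl]]|[ix x01 cl]]; [split=> //|split=> //; split=> //];
  move=> e /cl[N HN]; exists N => j /HN;
  by rewrite (fstar_term_psum th_root f_shift h_pos h_neg) // posw_dg.
Qed.

Lemma fset01 Q x : fset Q x -> irr x /\ 0 < x < 1.
Proof. by case=> l [/fstar_isP[ix x01 _] _]. Qed.

Lemma dg_drop (x : R) m n : drop m (dg x (n + m)) = dg x n.
Proof. by elim: m => [|m IH]; rewrite ?addn0 ?drop0 // addnS dgS /= IH. Qed.

Lemma phi_cvg (u : nat -> R[i]) l : ccvg_to u l ->
  forall e, 0 < e -> exists N, forall j, (N <= j)%N -> `|phi (u j) - phi l| < e.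
Proof.
have [L L0 HL] := phi_bound phi_lin.
move=> cl e e0; have [|N HN] := cl (e / L); first by rewrite divr_gt0.
exists N => j /HN; rewrite -(phiB phi_lin) ltr_pdivlMr // mulrC.
by apply: le_lt_trans; apply: HL.
Qed.

(** Existence of the limit is a Cauchy criterion, and the bound on it is a countable family of
    strict bounds on partial sums; each single condition depends on finitely many digits. *)
Lemma measurable_fset_le t : measurable (fset (fun y => y <= t)).
Proof.
pose u (x : R) j := psum (dg x (2 * j + 1)).
(* Dropping the 2 j latest digits recovers the shorter prefix, so both partial sums are read off one
   word. *)
pose C1 n N j : set R := [set x | [/\ irr x, 0 < x < 1 &
  (fun s => is_true (cabs (psum s - psum (drop (2 * j) s)) < n.+1%:R^-1)) (dg x (2 * (N + j) + 1))]].
pose C2 n N j : set R := [set x | [/\ irr x, 0 < x < 1 &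
  (fun s => is_true (phi (psum s) < t + n.+1%:R^-1)) (dg x (2 * (N + j) + 1))]].
have C1E n N j x : C1 n N j x <-> [/\ irr x, 0 < x < 1 & cabs (u x (N + j)%N - u x N) < n.+1%:R^-1].
  rewrite /C1 /u /=; have -> : (2 * (N + j) + 1 = 2 * N + 1 + 2 * j)%N by lia.
  by rewrite dg_drop.
have inv0 (n : nat) : 0 < n.+1%:R^-1 :> R by rewrite invr_gt0.
have small (e : R) : 0 < e -> exists n : nat, n.+1%:R^-1 < e.
  by exists (Num.truncn e^-1); exact: inv_truncn.
rewrite (_ : fset _ = (\bigcap_n \bigcup_N \bigcap_j C1 n N j) `&`
                      (\bigcap_n \bigcup_N \bigcap_j C2 n N j)).
  apply: measurableI; apply: bigcapT_measurable => n; apply: bigcupT_measurable => N;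
    by apply: bigcapT_measurable => j; exact: measurable_dg.
apply/seteqP; split=> x.
  move=> [l [/fstar_isP[ix x01 cl] lt]]; split=> n _.
    have e2 : 0 < n.+1%:R^-1 / 2 :> R by rewrite divr_gt0.
    have [N HN] := cl _ e2; exists N => // j _; apply/C1E; split => //.
    apply: le_lt_trans (cabs_distD l _ _) _; rewrite [cabs (l - _)]cabsBC.
    by rewrite [ltRHS]splitr ltrD // HN // leq_addr.
  have [N HN] := phi_cvg cl (inv0 n); exists N => // j _; split=> //.
  have := HN (N + j)%N (leq_addr _ _); rewrite ltr_norml => /andP[_].
  by rewrite ltrBlDl => /lt_le_trans; apply; rewrite lerD2r.
move=> [H1 H2].
have [ix x01] : irr x /\ 0 < x < 1.
  by have [N _ /(_ 0%N Logic.I)[]] := H1 0%N Logic.I.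
have [l cl] : exists l, ccvg_to (u x) l.
  apply: cauchy_cvg_complex => e /small[n ne]; have [N _ HN] := H1 n Logic.I.
  by exists N => j; apply: lt_trans ne; have /C1E[] := HN j Logic.I.
exists l; split; first exact/fstar_isP.
apply/ler_addgt0Pr => e e0; have [|n ne] := small (e / 2); first by rewrite divr_gt0.
have [N _ HN] := H2 n Logic.I.
have e20 : 0 < e / 2 by rewrite divr_gt0.
have [M HM] := phi_cvg cl e20.
have h1 : phi (u x (N + M)%N) < t + n.+1%:R^-1 by have [] := HN M Logic.I.
have := HM (N + M)%N (leq_addl _ _); rewrite ltr_norml => /andP[h2 _].
by move: (n.+1%:R^-1) (phi (u x (N + M)%N)) (phi l) ne h1 h2 => w y z; lra.
Qed.

Lemma fset_eqE t : fset (fun y => y = t) =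
  fset (fun y => y <= t) `\` \bigcup_n fset (fun y => y <= t - n.+1%:R^-1).
Proof.
apply/seteqP; split=> x.
  move=> [l [fl lt]]; split; first by exists l; rewrite lt.
  move=> [n _ [l' [fl']]].
  have /fstar_isP[_ _ c1] := fl; have /fstar_isP[_ _ c2] := fl'.
  rewrite -(ccvg_unique c1 c2) lt; apply/negP; rewrite -ltNge ltrBlDr ltrDl.
  by rewrite invr_gt0.
move=> [[l [fl lt]] H]; exists l; split => //; apply/eqP; rewrite eq_le lt /= leNgt.
apply/negP => lt'; apply: H; exists (Num.truncn (t - phi l)^-1) => //.
by exists l; split => //; rewrite lerBrDr -lerBrDl ltW // inv_truncn // subr_gt0.
Qed.

Lemma measurable_fset_eq t : measurable (fset (fun y => y = t)).
Proof.
rewrite fset_eqE; apply: measurableD; first exact: measurable_fset_le.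
by apply: bigcupT_measurable => n; exact: measurable_fset_le.
Qed.

(** A monotone function is continuous where it has no jump, and the sets [G n], which control the
    variation near t, decrease to the level set at t. *)
Lemma cdf_continuous : (forall t, mu (fset (fun y => y = t)) = 0%E) ->
  continuous (fun t => mu (fset (fun y => y <= t))).
Proof.
move=> H0 t.
pose F t := fset (fun y => y <= t).
have mF s : measurable (F s) := measurable_fset_le s.
have FS s1 s2 : s1 <= s2 -> F s1 `<=` F s2.
  by move=> s12 x [l [fl lt]]; exists l; split => //; apply: le_trans s12.
have Ffin s : (mu (F s) < +oo)%E.
  apply: (@le_lt_trans _ _ (mu `]0%R, 1%R[)).
    by apply: le_mu => // x /fset01[_ x01]; rewrite /= in_itv.
  by rewrite lebesgue_measure_itv /= lte_fin ltr01 -EFinB ltry.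
have Ffn s : mu (F s) \is a fin_num by rewrite ge0_fin_numE.
pose G n := F (t + n.+1%:R^-1) `\` F (t - n.+1%:R^-1).
have mG n : measurable (G n) by exact: measurableD.
have inv0 (n : nat) : 0 < n.+1%:R^-1 :> R by rewrite invr_gt0.
have GE : \bigcap_n G n = fset (fun y => y = t).
  apply/seteqP; split=> x.
    move=> H; have [[l [fl lt]] _] := H 0%N Logic.I; exists l; split => //.
    have lu l' : fstar_is th k f x l' -> l' = l.
      by move=> /fstar_isP[_ _ c1]; have /fstar_isP[_ _ c2] := fl; apply: ccvg_unique c1 c2.
    apply/eqP; rewrite eq_le; apply/andP; split; apply/ler_addgt0Pr => e e0.
      have [[l' [/lu -> hle]] _] := H (Num.truncn e^-1) Logic.I.
      by apply: le_trans hle _; rewrite lerD2l ltW // inv_truncn.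
    have [_ nF] := H (Num.truncn e^-1) Logic.I.
    rewrite leNgt; apply/negP => lt'; apply: nF; exists l; split => //.
    rewrite lerBrDr; apply: le_trans (ltW lt').
    by rewrite lerD2l ltW // inv_truncn.
  move=> [l [fl lt]] n _; split; first by exists l; split => //; rewrite lt lerDl ltW.
  move=> [l' [fl']].
  have /fstar_isP[_ _ c1] := fl; have /fstar_isP[_ _ c2] := fl'.
  by rewrite -(ccvg_unique c1 c2) lt; apply/negP; rewrite -ltNge ltrBlDr ltrDl.
have Gc : mu \o G @ \oo --> mu (\bigcap_n G n).
  apply: nonincreasing_cvg_mu => //.
  - by apply: (le_lt_trans _ (Ffin (t + 1%:R^-1))); apply: le_mu => // x [].
  - by rewrite GE; exact: measurable_fset_eq.
  move=> m n mn; apply/subsetPset => x [Fx nFx].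
  have hmn : n.+1%:R^-1 <= m.+1%:R^-1 :> R by rewrite lef_pV2 ?posrE // ler_nat.
  by split; [apply: FS Fx; rewrite lerD2l|move=> Fx'; apply: nFx; apply: FS Fx'; rewrite lerD2l lerN2].
rewrite GE H0 in Gc.
change (mu (F s) @[s --> t] --> mu (F t)); rewrite -(fineK (Ffn t)).
apply/fine_cvgP; split; first by apply: nearW => s; exact: Ffn.
apply/cvgrPdist_lt => e e0.
have [n Gn] : exists n, (mu (G n) < e%:E)%E.
  move/fine_cvgP: Gc => [[N1 _ HN1] /cvgrPdist_lt/(_ _ e0)[N2 _ HN2]].
  exists (maxn N1 N2); have := HN1 (maxn N1 N2) (leq_maxl _ _).
  have := HN2 (maxn N1 N2) (leq_maxr _ _); rewrite /= sub0r normrN => h1 h2.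
  by rewrite -(fineK h2) lte_fin; apply: le_lt_trans h1; apply: ler_norm.
have dE : fine (mu (F (t + n.+1%:R^-1))) - fine (mu (F (t - n.+1%:R^-1))) < e.
  rewrite -lte_fin EFinB !fineK //; apply: le_lt_trans Gn.
  rewrite leeBlDr //.
  rewrite /G; set s1 := t - _; set s2 := t + _.
  have mm : mu (F s2) = (mu (F s2 `\` F s1) + mu (F s2 `&` F s1))%E
    by exact: (measureDI mu (mF s2) (mF s1)).
  by rewrite mm leeD2l //; apply: le_mu => //; exact: measurableI.
have mono s1 s2 : s1 <= s2 -> fine (mu (F s1)) <= fine (mu (F s2)).
  by move=> s12; apply: fine_le => //; apply: le_mu => //; exact: FS.
near=> s.
have /andP[s1 s2] : t - n.+1%:R^-1 < s < t + n.+1%:R^-1.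
  rewrite -ltr_distlC; near: s; apply/nbhs_ballP; exists n.+1%:R^-1 => //= s; rewrite -ball_normE.
have := mono _ _ (ltW s1); have := mono _ _ (ltW s2).
have h1 : fine (mu (F (t - n.+1%:R^-1))) <= fine (mu (F t)) by apply: mono; rewrite gerBl ltW.
have h2 : fine (mu (F t)) <= fine (mu (F (t + n.+1%:R^-1))) by apply: mono; rewrite lerDl ltW.
rewrite -/(F t) -/(F s) /= ltr_norml; lra.
Unshelve. all: by end_near. Qed.

Section Key.
Variables (dl C : R).
Hypothesis dl0 : 0 < dl < 1.
Hypothesis h_bound : forall x : R, 0 < `|x| <= 1 -> cabs (h x) <= C * expR (`|x| `^ (-1 + dl)).

(** Around a density point of the level set, the part of a long cylinder outside the bad set meets
    the level set. At a common point f-star has phi-value t and lies within the tail bound of the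
    partial sum. *)
Lemma key_estimate t : mu (fset (fun y => y = t)) != 0%E ->
  exists x0 : R, [/\ irr x0, 0 < x0 < 1 & exists2 K, 0 < K &
    forall M : nat, exists n0, forall n, (n0 <= n)%N ->
    forall W, posw W -> (size W <= M)%N -> all (fun b => b <= Posz M) W ->
    `|phi (psum (W ++ dg x0 n)) - t| <= K * qk (W ++ dg x0 n)].
Proof.
move=> A0; have mA := measurable_fset_eq t.
have [x0 Ax0 Hx0] := density_words mA A0 (@fset01 _).
have [ix0 x001] := fset01 Ax0.
exists x0; split => //.
have a0 := tail_rate_gt0 k_gt0.
have h20 : 0 < 2^-1 :> R by rewrite invr_gt0.
(* This [D] makes the bad part at most half of any cylinder. *)
have [D D0 HD] := bad_small a0 dl0 h20.
have [L L0 HL] := phi_bound phi_lin.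
exists (L * (1 + tail_const k C D)).
  have C0 := C_ge0 h_bound.
  rewrite mulr_gt0 // ltr_pwDl // /tail_const divr_ge0 // ?mulr_ge0 ?expR_ge0 //.
  by rewrite subr_ge0 ltW // expR_lt1 oppr_lt0.
move=> M; have [n0 Hn0] := Hx0 M; exists n0 => n nn W pW sW bW.
have pd := posw_dg n ix0 x001.
set r := W ++ dg x0 n; have pr : posw r by rewrite all_cat pW.
pose bd := bad (tail_rate k) dl r D.
have mbd : measurable bd by exact: measurable_bad.
have mc := @measurable_cyl R _ pr.
have mB : measurable (cyl r `\` bd) by exact: measurableD.
have [||x [l [fl lt]] [cx nb]] := Hn0 n nn W pW sW bW (cyl r `\` bd) mB.
- by move=> y [].
- have dE : mu (cyl r) = (mu (cyl r `\` bd) + mu (cyl r `&` bd))%E by exact: measureDI.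
  have le2 : (mu (cyl r `&` bd) <= (2^-1)%:E * mu (cyl r))%E.
    apply: (@le_trans _ _ (mu bd)); first by apply: le_mu => //; exact: measurableI.
    apply: le_trans (mu_bad a0 dl0 pr D0) _; rewrite lee_wpmul2r // lee_fin //.
  move: dE le2; rewrite -/r mu_cyl // -EFinM.
  set c := 1 / _; case: (mu (cyl r `&` bd)) => [y| |] //; case: (mu (cyl r `\` bd)) => [z| |] //=.
  by rewrite -EFinD => -[cE]; rewrite !lee_fin; lra.
have /cylP[ix x01 dE] := cx.
have [||l' fl'] := @fstar_good R k th f h k_gt0 th_root f_shift h_pos h_neg dl C dl0 h_bound x (size r) D D0.
- by rewrite dE.
- by rewrite dE.
rewrite dE => bl.
have /fstar_isP[_ _ c1] := fl; have /fstar_isP[_ _ c2] := fl'.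
rewrite -(ccvg_unique c1 c2) in bl.
rewrite -lt -(phiB phi_lin); apply: le_trans (HL _) _; rewrite -mulrA ler_pM2l //.
apply: le_trans bl _; rewrite ler_pM2r ?expR_gt0 // lerDr //.
Qed.

End Key.
End Law.

(** * Tuning the phase *)

(** The parity of the prefix length will give the argument of h its sign. *)
Lemma exists_parity (n0 : nat) (b : bool) : exists2 n, (n0 <= n)%N & odd n = b.
Proof.
exists (n0 + (odd n0 (+) b))%N; first exact: leq_addr.
by rewrite oddD; case: (odd n0); case: b.
Qed.

Lemma alt_cat v c P : alt (v ++ c :: P) = alt (v ++ 0 :: P) + (-1) ^+ (size P).+1 * c.
Proof.
elim: v => [|b v IH] /=; first by rewrite mulr0 addr0.
by rewrite IH !size_cat /=; ring.
Qed.

(** One digit enters the exponent linearly, so its residue modulo the order of [th] determines the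
    power of [th]. *)
Lemma ex_cat v c P : ex (v ++ c :: P) = ex (v ++ 0 :: P) - (-1) ^+ (size P).+1 * c.
Proof. by rewrite /ex alt_cat !size_cat /=; ring. Qed.

Section Tuning.
Variables (R : realType) (k th : R[i]).
Hypothesis th_root : exists n : nat, (0 < n)%N /\ th ^+ n = 1.

Lemma tune (N : nat) (eta B0 : R) : (0 < N)%N -> 0 < eta -> exists T0, forall (T rho : R) (r0 : int),
  T0 <= T -> 0 <= rho <= 2 -> exists c : int, [/\ exists z : int, c = r0 + N%:Z * z,
    B0 <= c%:~R, 0 < c & T < ln (c%:~R + rho) < T + eta].
Proof.
(* As expR T >= 1 + T, this makes expR T * eta exceed N, so that the window for c + rho is longer
   than one period of the residue class, and it keeps c above [B0] and 0. *)
move=> N0 eta0; exists (N%:R / eta + `|B0| + 3) => T rho r0 TT /andP[rho0 rho2].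
have NR : 0 < N%:R :> R by rewrite ltr0n.
have XT := expR_ge1Dx T; set X := expR T in XT *.
have Ne : 0 < N%:R / eta by rewrite divr_gt0.
have B0' : B0 <= `|B0| by apply: ler_norm.
have B0'' : 0 <= `|B0| by [].
(* The resulting c is the first element of its class beyond expR T - rho. *)
pose z := Num.floor ((X - rho - r0%:~R) / N%:R) + 1.
have /andP[z1 z2] := floor_itv ((X - rho - r0%:~R) / N%:R).
have {}z1 : z%:~R - 1 <= (X - rho - r0%:~R) / N%:R by rewrite /z rmorphD /= addrK.
rewrite -/z in z2; rewrite ltr_pdivrMr // in z2; rewrite ler_pdivlMr // in z1.
pose c := r0 + N%:Z * z.
have cE : c%:~R = r0%:~R + z%:~R * N%:R :> R by rewrite /c rmorphD rmorphM /= mulrC.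
have c1 : X - rho < c%:~R by rewrite cE; lra.
have c2 : c%:~R <= X - rho + N%:R by rewrite cE; lra.
have c0 : 0 < c%:~R :> R by lra.
exists c; split; [by exists z|by lra|by rewrite -(ltr0z R)|].
have cr0 : 0 < c%:~R + rho by rewrite ltr_wpDr.
rewrite -[T in T < _]expRK ltr_ln ?posrE ?expR_gt0 // -/X; apply/andP; split; first lra.
rewrite -[ltRHS]expRK ltr_ln ?posrE ?expR_gt0 // expRD -/X.
have e1 := expR_ge1Dx eta.
have Xe : N%:R < X * eta.
  rewrite -ltr_pdivrMr //; lra.
have : X * (1 + eta) <= X * expR eta by rewrite ler_pM2l // expR_gt0.
lra.
Qed.

Lemma th_periodic (N : nat) (x z : int) : th ^+ N = 1 -> th ^ (x + N%:Z * z) = th ^ x.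
Proof.
move=> thN; rewrite expfzDr ?(th_neq0 th_root) // -exprz_exp -exprnP thN exp1rz mulr1 //.
Qed.

(** The denominator of [v ++ c :: P] factors as [kap v P] times [c + rho v P], which displays its
    dependence on the digit c. *)
Definition rho (v P : seq int) : R := (cq' P)%:~R / (cq P)%:~R + (cp v)%:~R / (cq v)%:~R.
Definition kap (v P : seq int) : R := (cq v)%:~R * (cq P)%:~R.

Lemma rho_itv v P : posw v -> posw P -> 0 <= rho v P <= 2.
Proof.
move=> pv pP; have [q0 q0' qq] := cq_bounds pP; have [Q0 _ _] := cq_bounds pv.
have [p0 _ pq _] := cp_le_cq pv.
have q0R : 0 < (cq P)%:~R :> R by rewrite ltr0z.
have Q0R : 0 < (cq v)%:~R :> R by rewrite ltr0z.
have /andP[h1 h2] : 0 <= ((cq' P)%:~R / (cq P)%:~R : R) <= 1.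
  by rewrite divr_ge0 ?ler0z ?(ltW q0) //= ler_pdivrMr // mul1r ler_int.
have /andP[h3 h4] : 0 <= ((cp v)%:~R / (cq v)%:~R : R) <= 1.
  by rewrite divr_ge0 ?ler0z ?(ltW Q0) //= ler_pdivrMr // mul1r ler_int.
rewrite /rho; lra.
Qed.

Lemma kap_gt0 v P : posw v -> posw P -> 0 < kap v P.
Proof. by move=> pv pP; rewrite mulr_gt0 // ltr0z cq_gt0. Qed.

Lemma cq_tune v c P : posw v -> posw P -> (cq (v ++ c :: P))%:~R = kap v P * (c%:~R + rho v P).
Proof.
move=> pv pP; rewrite (cq_cat v (c :: P)).1 cq_cons cq'_cons /kap /rho !rmorphD !rmorphM rmorphD rmorphM /=.
by field; rewrite !intr_eq0 !gt_eqF // cq_gt0.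
Qed.

(** The unimodular part of the coefficient th^e q^(-k) in [trm]; the modulus is [qk]. *)
Definition phase (r : seq int) : R[i] :=
  th ^ ex r * eC (- complex.Im k * ln (cq r)%:~R / (2 * pi)).

Lemma cabs_phase r : cabs (phase r) = 1.
Proof. by rewrite cabsM cabs_exprz ?(cabs_th th_root) // cabs_eC mulr1. Qed.

Lemma trm_polar (h : R -> R[i]) r : trm k th h r =
  ((qk k r)%:C * (phase r * h ((-1) ^+ (size r).+1 * ratr (cy r))))%C.
Proof.
rewrite /trm cpow_polar /phase /qk.
have -> : complex.Re (- k) = - complex.Re k by case: (k).
have -> : complex.Im (- k) = - complex.Im k by case: (k).
ring.
Qed.

(* Which phases can be reached: powers of th when k is real, and arbitrarily small
   arcs of the unit circle, through the factor q^(- i Im k), otherwise. *)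
Definition reachable (Zt : R[i] -> Prop) : Prop :=
  (complex.Im k = 0 /\ exists p : int, Zt (th ^ p)) \/
  (complex.Im k <> 0 /\ exists b e : R, 0 < e /\ forall a, `|a - b| < e -> Zt (eC a)).

(** The bound [M] is fixed before [v] and [P], because the estimate near an atom holds for words of
    bounded size only. *)
Lemma phase_tune (Zt : R[i] -> Prop) (B0 : R) : reachable Zt ->
  exists M : nat, forall v P, posw v -> posw P -> exists c : int,
    [/\ 0 < c, B0 <= c%:~R, c <= Posz M & Zt (phase (v ++ c :: P))].
Proof.
have [N [N0 thN]] := th_root.
have bnd (T : R) (c : int) (r : R) : 0 <= r -> 0 < c%:~R + r -> ln (c%:~R + r) < T ->
    c <= Posz (Num.truncn (expR T)).+1.
  move=> r0 cr0 lT.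
  have h1 : c%:~R + r < expR T by rewrite -[ltLHS]lnK ?posrE // ltr_expR.
  have h2 := truncnS_gt (expR T).
  rewrite -(ler_int R) -[(Posz _)%:~R]/((Num.truncn (expR T)).+1%:R); lra.
case=> [[k0 [p Zp]]|[k0 [b [e [e0 Ze]]]]].
  have [T0 HT] := tune B0 N0 (@ltr01 R).
  exists (Num.truncn (expR (T0 + 1))).+1 => v P pv pP.
  have r02 := rho_itv pv pP; have /andP[r0 r2] := r02.
  pose s : int := (-1) ^+ (size P).+1.
  have ss : s * s = 1 by rewrite -expr2 sqrr_sign.
  (* The residue of c modulo N is chosen to bring the exponent to p modulo N. *)
  have [c [[z cE] cB c0 /andP[_ cT]]] := HT T0 (rho v P) (s * (ex (v ++ 0 :: P) - p)) (lexx _) r02.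
  have c0R : 0 < c%:~R :> R by rewrite ltr0z.
  exists c; split => //; first by apply: bnd cT => //; rewrite ltr_wpDr.
  rewrite /phase k0 oppr0 !mul0r eC0 mulr1 ex_cat -/s.
  have -> : ex (v ++ 0 :: P) - s * c = p + N%:Z * (- s * z).
    by rewrite cE mulrDr mulrA ss; ring.
  by rewrite th_periodic.
pose w := complex.Im k / (2 * pi).
have pi20 : 2 * pi != 0 :> R by rewrite mulf_neq0 // gt_eqF // pi_gt0.
have w0 : w != 0 by rewrite mulf_neq0 ?invr_eq0 //; apply/eqP.
have w0' : 0 < `|w| by rewrite normr_gt0.
have eta0 : 0 < e / `|w| by rewrite divr_gt0.
have [T0 HT] := tune B0 N0 eta0.
exists (Num.truncn (expR (T0 + 1 / `|w| + e / `|w|))).+1 => v P pv pP.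
have r02 := rho_itv pv pP; have /andP[r0 r2] := r02.
have [a1 a1E] := cabs1_eC (cabs_exprz (ex (v ++ 0 :: P)) (cabs_th th_root)).
(* Counted in turns, the phase is a1 - w ln q with ln q = ln kap + ln (c + rho). For ln (c + rho) =
   T0 + tau it equals b modulo 1 when w tau = g0 - n; rounding g0 suitably to an integer n leaves 0
   <= tau <= 1 / |w|. *)
pose g0 := a1 - b - w * ln (kap v P) - w * T0.
pose n : int := if 0 < w then Num.floor g0 else Num.floor g0 + 1.
have /andP[f1 f2] := floor_itv g0; rewrite rmorphD /= in f2.
have tauE : 0 <= (g0 - n%:~R) / w <= 1 / `|w|.
  rewrite /n; case: ltP => wp.
    rewrite gtr0_norm // divr_ge0 ?subr_ge0 ?(ltW wp) //= ler_pM2r ?invr_gt0 //; lra.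
  have wn : w < 0 by rewrite lt_neqAle w0.
  rewrite ltr0_norm // -mulrNN -invrN divr_ge0 ?oppr_ge0 //=; last 1 first.
    by rewrite rmorphD /=; lra.
  rewrite ler_pM2r ?invr_gt0 ?oppr_gt0 // rmorphD /=; lra.
have /andP[t0 t1] := tauE; set tau := _ / w in t0 t1.
(* Residue 0 keeps the power of [th] equal to [eC a1], and the window e / |w| for the logarithm
   moves the phase by less than e. *)
have [|c [[z cE] cB c0 /andP[cT1 cT2]]] := HT (T0 + tau) (rho v P) 0 _ r02; first by rewrite lerDl.
have c0R : 0 < c%:~R :> R by rewrite ltr0z.
have cr0 : 0 < c%:~R + rho v P by rewrite ltr_wpDr.
exists c; split => //.
  by apply: bnd r0 cr0 _; apply: lt_le_trans cT2 _; rewrite lerD2r lerD2l.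
have thE : th ^ ex (v ++ c :: P) = eC a1.
  rewrite -a1E ex_cat cE add0r.
  have -> : ex (v ++ 0 :: P) - (-1) ^+ (size P).+1 * (N%:Z * z) =
    ex (v ++ 0 :: P) + N%:Z * (- ((-1) ^+ (size P).+1 * z)) by ring.
  by rewrite th_periodic.
rewrite /phase thE -eCD cq_tune // lnM ?posrE ?kap_gt0 //.
have wt : w * tau = a1 - b - w * ln (kap v P) - w * T0 - n%:~R by rewrite mulrC divfK.
set X := ln (c%:~R + _) in cT1 cT2 *; set Y := ln (kap v P) in wt *.
have -> : a1 + - complex.Im k * (Y + X) / (2 * pi) = (b - w * (X - (T0 + tau))) + n%:~R.
  have -> : - complex.Im k * (Y + X) / (2 * pi) = - w * (Y + X) by rewrite /w -mulNr mulrAC.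
  lra.
rewrite eCD eC_int mulr1; apply: Ze.
rewrite addrAC subrr add0r normrN normrM mulrC -ltr_pdivlMr //.
by rewrite ger0_norm; lra.
Qed.

End Tuning.

(** * Absence of atoms *)

Section Auxiliary.
Local Open Scope classical_set_scope.
Variable R : realType.

Lemma cpowNK (x : R) z : cpow x z * cpow x (- z) = 1.
Proof.
rewrite !cpow_polar; case: z => a b /=.
have -> : ((expR (a * ln x))%:C * eC (b * ln x / (2 * pi)) *
   ((expR (- a * ln x))%:C * eC (- b * ln x / (2 * pi))))%C =
   ((expR (a * ln x))%:C * (expR (- a * ln x))%:C)%C *
   (eC (b * ln x / (2 * pi)) * eC (- b * ln x / (2 * pi))) by ring.
rewrite -rmorphM -expRD -eCD !mulNr !subrr expR0 eC0 mulr1 //.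
Qed.

Lemma eC_continuous (b e : R) : 0 < e -> exists2 d : R, 0 < d &
  forall a, `|a - b| < d -> cabs (eC a - eC b) < e.
Proof.
move=> e0; have e20 : 0 < e / 2 by rewrite divr_gt0.
have lin : continuous (fun a : R => 2 * pi * a).
  by move=> a; apply: cvgMr; exact: cvg_id.
have cc : {for b, continuous (fun a : R => cos (2 * pi * a))}.
  by apply: continuous_comp; [exact: lin|exact: continuous_cos].
have cs : {for b, continuous (fun a : R => sin (2 * pi * a))}.
  by apply: continuous_comp; [exact: lin|exact: continuous_sin].
move/cvgrPdist_lt : cc => /(_ _ e20)/nbhs_ballP[d1 /= d10 H1].
move/cvgrPdist_lt : cs => /(_ _ e20)/nbhs_ballP[d2 /= d20 H2].
exists (Num.min d1 d2) => [|a]; first by rewrite lt_min d10 d20.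
rewrite lt_min => /andP[a1 a2].
have := H1 a; rewrite -ball_normE /= distrC => /(_ a1).
have := H2 a; rewrite -ball_normE /= distrC => /(_ a2) h2 h1.
apply: le_lt_trans (cabs_le_ReIm _) _ => /=.
rewrite distrC in h1; rewrite distrC in h2; rewrite [e]splitr; exact: ltrD.
Qed.

Lemma exists_irr (x y : R) : x < y -> exists2 z, irr z & x < z < y.
Proof.
move=> xy; apply: contrapT => H.
have := @mu_irrI R `]x, y[ (measurable_itv _).
rewrite (_ : _ `&` _ = set0).
  rewrite measure0 lebesgue_measure_itv /= lte_fin xy -EFinB => -[] /esym/eqP.
  by rewrite subr_eq0 gt_eqF.
by apply/seteqP; split => z //= [iz zxy]; apply: H; exists z => //; rewrite in_itv in zxy.
Qed.

Lemma mob_dist r (s t : R) : posw r -> 0 <= s <= 1 -> 0 <= t <= 1 ->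
  `|mob r s - mob r t| <= 1 / (cq r)%:~R ^+ 2.
Proof.
move=> pr /andP[s0 s1] /andP[t0 t1]; have [q0 q0' qq] := cq_bounds pr.
have qR : 0 < (cq r)%:~R :> R by rewrite ltr0z.
have qR' : 0 <= (cq' r)%:~R :> R by rewrite ler0z.
rewrite !mobE //; set D1 := _ + s * (cq' r)%:~R; set D2 := _ + t * (cq' r)%:~R.
have D10 : (cq r)%:~R <= D1 by rewrite lerDl mulr_ge0.
have D20 : (cq r)%:~R <= D2 by rewrite lerDl mulr_ge0.
have D1p : 0 < D1 by apply: lt_le_trans D10.
have D2p : 0 < D2 by apply: lt_le_trans D20.
have -> : ((cp r)%:~R + s * (cp' r)%:~R) / D1 - ((cp r)%:~R + t * (cp' r)%:~R) / D2 =
    (-1) ^+ size r * ((s - t) / (D1 * D2)).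
  have := cont_det r => /(congr1 (fun z : int => z%:~R : R)).
  rewrite rmorphB !rmorphM rmorphXn rmorphN1 /= => <-.
  by rewrite /D1 /D2; field; rewrite -/D1 -/D2 !gt_eqF.
rewrite normrMsign normrM normfV [`|D1 * D2|]gtr0_norm ?mulr_gt0 //.
apply: ler_pM => //; first by rewrite invr_ge0 mulr_ge0 // ltW.
  by rewrite ler_norml; lra.
rewrite lef_pV2 ?posrE ?mulr_gt0 ?exprn_gt0 // expr2.
by apply: ler_pM => //; exact: ltW.
Qed.

Lemma mob_dg (x : R) n : irr x -> 0 < x < 1 -> mob (dg x n) (iter n (@gauss R) x) = x.
Proof.
move=> ix x01; elim: n => [//|n IH]; rewrite dgS mob_cons -[RHS]IH; congr mob.
by rewrite /cf_digit /= gaussE addrC subrK div1r invrK.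
Qed.

(** The latest digits lead in [cy], so a word [v] put on top prescribes how the argument of h
    begins. *)
Lemma cy_cat v s : cy (v ++ s) = mob (rev v) (cy s).
Proof. by rewrite /cy /cf_eval /mob foldr_cat foldl_rev. Qed.

Lemma ratr_mob r (t : rat) : ratr (mob r t) = mob r (ratr t) :> R.
Proof.
elim: r t => [//|b r IH] t; rewrite !mob_cons IH; congr mob.
by rewrite fmorph_div rmorph1 rmorphD /= ratr_int.
Qed.

Lemma ratr_cy r : posw r -> ratr (cy r) = (cq' r)%:~R / (cq r)%:~R :> R.
Proof. by move=> pr; rewrite cyE // fmorph_div /= !ratr_int. Qed.

Lemma seq_bound (s : seq int) : exists M : nat, all (fun b => b <= Posz M) s.
Proof.
elim: s => [|b s [M HM]]; first by exists 0%N.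
exists (maxn M `|b|) => /=; apply/andP; split; first lia.
by apply: sub_all HM => c; lia.
Qed.

End Auxiliary.

(** * The two contradiction arguments against an atom *)

Section NoAtoms.
Local Open Scope classical_set_scope.
Variables (R : realType) (k th : R[i]) (f : rat -> R[i]) (h : R -> R[i]) (phi : R[i] -> R).
Local Notation mu := (@lebesgue_measure R).
Hypothesis k_gt0 : 0 < complex.Re k.
Hypothesis th_root : exists n : nat, (0 < n)%N /\ th ^+ n = 1.
Hypothesis f_shift : forall x : rat, f (x + 1) = th * f x.
Hypothesis h_pos : forall x : rat, 0 < x ->
  h (ratr x) = f x - th ^ 3%:Z * cpow (ratr `|x|) (- k) * f (- x^-1).
Hypothesis h_neg : forall x : rat, x < 0 ->
  h (ratr x) = f x - th ^ (- 3)%Z * cpow (ratr `|x|) (- k) * f (- x^-1).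
Hypothesis phi_lin :
  forall (r : R) (z w : R[i]), phi ((r%:C)%C * z + w) = r * phi z + phi w.

Local Notation psum := (psum k th f h).
Local Notation qk := (qk k).
Local Notation phase := (phase k th).
Local Notation trm := (trm k th h).

Local Ltac prune := clear -k_gt0 th_root f_shift h_pos h_neg phi_lin.

Lemma coef_polar r : th ^ ex r * cpow (cq r)%:~R (- k) = ((qk r)%:C * phase r)%C.
Proof. by have := trm_polar k th (fun=> 1) r; rewrite trmE !mulr1. Qed.

(** The set [Zt] of admissible phases merges the real and the nonreal case of (2-star), for one
    fixed pair e < e'. *)
Lemma no_atom_unbounded (dl C s e e' c0 d0 : R) (Zt : R[i] -> Prop) :
    0 < dl < 1 ->
    (forall x : R, 0 < `|x| <= 1 -> cabs (h x) <= C * expR (`|x| `^ (-1 + dl))) ->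
    s = 1 \/ s = -1 ->
    (forall M : R, exists2 d : R, 0 < d & forall x, 0 < s * x < d -> M < cabs (h x)) ->
    reachable k th Zt -> 0 < e < e' -> 0 < c0 -> 0 < d0 ->
    (forall x u z, 0 < s * x < d0 -> 0 < u -> e < `|ln u| < e' -> Zt z ->
       c0 <= `|phi (z * ((h x - cpow u k * h (u * x)) / ((cabs (h x))%:C)%C))|) ->
  forall t, mu (fset k th f phi (fun y => y = t)) = 0%E.
Proof.
move=> dl0 h_bound s1 h_inf reach /andP[e0 ee'] c00 d00 Hz t; apply/eqP; apply: contrapT => /negP A0.
have [x0 [ix0 x001 [K K0 HK]]] :=
  key_estimate k_gt0 th_root f_shift h_pos h_neg phi_lin dl0 h_bound A0.
(* Past this size of h, the lower bound c0 |h| exceeds the sum 2 K of the two error constants. *)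
have [d1 d10 Hd1] := h_inf (2 * K / c0).
pose D := Num.min d0 d1; have D0 : 0 < D by rewrite lt_min d00 d10.
have [N [N0 thN]] := th_root.
have [|T0 HT] := @tune R N (e' - e) 1 N0; first by rewrite subr_gt0.
(* The first bound on c brings x = s / (c + rh) within D of 0; the second lets [tune] start from ln
   (c + rh) + e. *)
have [M HM] := phase_tune th_root (Num.max (1 / D + 1) (expR T0)) reach.
(* The second digit will satisfy c' < (M + 2) expR e'. *)
pose M' := maxn (maxn M 1) (Num.truncn ((M%:R + 2) * expR e')).+1.
have [n0 Hn0] := HK M'; have [n nn on] := exists_parity n0 (s == -1).
pose P := dg x0 n; have pP : posw P := posw_dg n ix0 x001.
have sE : (-1) ^+ n = s.
  rewrite -signr_odd on; case: s1 => ->; rewrite ?eqxx ?expr1 //.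
  by have -> : (1 == -1 :> R) = false by apply: gt_eqF; lra.
have [c [cp cB cM Zc]] := HM [::] P isT pP.
have r02 := rho_itv R (isT : posw [::]) pP; have /andP[r0 r2] := r02; set rh := rho _ _ _ in r02 r0 r2.
have cR : 0 < c%:~R :> R by rewrite ltr0z.
have cr0 : 0 < c%:~R + rh by rewrite ltr_wpDr.
move: cB; rewrite ge_max => /andP[cB1 cB2].
(* The companion c' is congruent to c modulo N, so both words carry the same power of [th], and ln
   ((c' + rh) / (c + rh)) lies in (e, e'). *)
have [|c' [[z c'E] _ c'0 /andP[cT1 cT2]]] := HT (ln (c%:~R + rh) + e) rh c _ r02.
  apply: (@le_trans _ _ (ln (c%:~R + rh))); last by rewrite lerDl ltW.
  rewrite -[T0]expRK ler_ln ?posrE ?expR_gt0 //; lra.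
have c'R : 0 < c'%:~R :> R by rewrite ltr0z.
have c'r0 : 0 < c'%:~R + rh by rewrite ltr_wpDr.
have cMR : c%:~R <= M%:R :> R by rewrite -[M%:R]/((Posz M)%:~R) ler_int.
have c'M : c' <= Posz M'.
  have h1 : c'%:~R + rh < (M%:R + 2) * expR e'.
    rewrite -[ltLHS]lnK ?posrE //.
    apply: (@lt_le_trans _ _ (expR (ln (c%:~R + rh) + e'))); first by rewrite ltr_expR; move: cT2; prune; lra.
    rewrite expRD lnK ?posrE // ler_pM2r ?expR_gt0 //.
    by move: cMR r2; prune; lra.
  have h2 := truncnS_gt ((M%:R + 2) * expR e').
  have h3 : (Num.truncn ((M%:R + 2) * expR e')).+1%:R <= M'%:R :> R by rewrite ler_nat leq_maxr.
  rewrite -(ler_int R) -[(Posz M')%:~R]/(M'%:R).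
  by move: h1 h2 h3 r0; prune; lra.
pose r := c :: P; pose r' := c' :: P.
have pr : posw r by rewrite /= cp.
have pr' : posw r' by rewrite /= c'0.
have M'1 : (1 <= M')%N by rewrite /M' !leq_max leqnn orbT.
have E1 : `|phi (psum r) - t| <= K * qk r.
  apply: (Hn0 n nn [:: c]) => //=; first by rewrite cp.
  rewrite andbT; apply: le_trans cM _; rewrite lez_nat; apply: leq_trans (leq_maxl _ _).
  exact: leq_maxl.
have E2 : `|phi (psum r') - t| <= K * qk r'.
  by apply: (Hn0 n nn [:: c']) => //=; rewrite ?c'0 ?c'M.
have kp := kap_gt0 R (isT : posw [::]) pP; set kk := kap _ _ _ in kp.
have qE : (cq r)%:~R = kk * (c%:~R + rh) := cq_tune R c (isT : posw [::]) pP.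
have q'E : (cq r')%:~R = kk * (c'%:~R + rh) := cq_tune R c' (isT : posw [::]) pP.
pose u := (c%:~R + rh) / (c'%:~R + rh).
have u0 : 0 < u by rewrite divr_gt0.
have qu : (cq r)%:~R = (cq r')%:~R * u :> R by rewrite qE q'E /u; field; rewrite gt_eqF.
have q0 : 0 < (cq r)%:~R :> R by rewrite ltr0z cq_gt0.
have q'0 : 0 < (cq r')%:~R :> R by rewrite ltr0z cq_gt0.
have lu : ln u = ln (c%:~R + rh) - ln (c'%:~R + rh) by rewrite ln_div.
have lu' : e < `|ln u| < e' by rewrite lu; move: cT1 cT2 e0; prune => cT1 cT2 e0; rewrite ltr0_norm; lra.
have qk' : qk r' <= qk r.
  rewrite !qkE ler_expR !mulNr lerN2 ler_pM2l // ler_ln ?posrE // qE q'E ler_pM2l // -ler_ln ?posrE //.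
  by move: cT1 e0; prune; lra.
have exE : th ^ ex r' = th ^ ex r.
  rewrite -[r']/([::] ++ c' :: P) -[r]/([::] ++ c :: P) (ex_cat [::] c') (ex_cat [::] c) c'E.
  have -> : ex ([::] ++ 0 :: P) - (-1) ^+ (size P).+1 * (c + N%:Z * z) =
    ex ([::] ++ 0 :: P) - (-1) ^+ (size P).+1 * c + N%:Z * (- ((-1) ^+ (size P).+1 * z)) by ring.
  by rewrite (th_periodic th_root).
pose x : R := s * ratr (cy r).
have yE : ratr (cy r) = (cq P)%:~R / (cq r)%:~R :> R := ratr_cy R pr.
have y'E : ratr (cy r') = u * ratr (cy r) :> R.
  rewrite yE (ratr_cy R pr') qu; field; rewrite !gt_eqF //.
have y0 : 0 < ratr (cy r) :> R by rewrite ltr0q cy_gt0.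
have ss : s * s = 1 by case: s1 => ->; rewrite ?mulr1 // mulrNN mulr1.
have sx : 0 < s * x < D.
  rewrite /x mulrA ss mul1r y0 /= yE qE /kk /kap /= mul1r invfM mulrA divff ?mul1r; last first.
    by rewrite gt_eqF // ltr0z cq_gt0.
  rewrite -[D]invrK ltf_pV2 ?posrE ?invr_gt0 // -div1r.
  by move: cB1 r0; prune; lra.
have sgr c2 : (-1) ^+ (size (c2 :: P)).+1 = s by rewrite /= size_dg !exprS !mulN1r opprK.
(* The common prefix cancels, and q'^(-k) = u^k q^(-k) gives the two last terms a common factor. *)
have diff : phi (psum r) - phi (psum r') = qk r * (cabs (h x) *
    phi (phase r * ((h x - cpow u k * h (u * x)) / ((cabs (h x))%:C)%C))).
  rewrite -(phiB phi_lin) !psum_cons opprD addrACA subrr add0r -!(phiZ phi_lin); congr phi.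
  have hx0 : ((cabs (h x))%:C)%C != 0.
    have /andP[h1 h2] := sx; have := Hd1 x; rewrite h1 (lt_le_trans h2) ?ge_min ?lexx ?orbT // => /(_ isT) h3.
    apply/eqP => -[] h4; move: h3; rewrite h4; apply/negP; rewrite -leNgt.
    by rewrite divr_ge0 ?mulr_ge0 // ltW.
  have -> : trm r = th ^ ex r * cpow (cq r)%:~R (- k) * h x by rewrite trmE sgr.
  have -> : trm r' = th ^ ex r * cpow (cq r)%:~R (- k) * (cpow u k * h (u * x)).
    rewrite trmE sgr exE y'E mulrCA -/x qu cpowM //.
    have uu := cpowNK u k.
    have -> : th ^ ex r * (cpow (cq r')%:~R (- k) * cpow u (- k)) * (cpow u k * h (u * x)) =
      th ^ ex r * cpow (cq r')%:~R (- k) * (cpow u k * cpow u (- k)) * h (u * x) by ring.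
    by rewrite uu mulr1.
  rewrite -mulrBr coef_polar; set X := h x - _.
  have {1}-> : X = ((cabs (h x))%:C)%C * (X / ((cabs (h x))%:C)%C) by rewrite mulrC divfK.
  ring.
have /andP[sx0 sxD] := sx.
have hc : c0 <= `|phi (phase r * ((h x - cpow u k * h (u * x)) / ((cabs (h x))%:C)%C))|.
  by apply: Hz => //; rewrite sx0 (lt_le_trans sxD) // ge_min lexx.
have hx : 2 * K / c0 < cabs (h x).
  by apply: Hd1; rewrite sx0 (lt_le_trans sxD) // ge_min lexx orbT.
rewrite ltr_pdivrMr // in hx.
have qkp : 0 < qk r by exact: expR_gt0.
have : `|phi (psum r) - phi (psum r')| <= K * qk r + K * qk r'.
  by rewrite -(subrKA t); apply: le_trans (ler_normD _ _) _; rewrite lerD // distrC.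
rewrite diff !normrM gtr0_norm // [`|cabs _|]ger0_norm ?cabs_ge0 //.
apply/negP; rewrite -ltNge.
apply: (@le_lt_trans _ _ (qk r * (2 * K))).
  by have := ler_wpM2l (ltW K0) qk'; prune; lra.
rewrite ltr_pM2l //; apply: lt_le_trans hx _.
by rewrite ler_wpM2l // cabs_ge0.
Qed.

(** The word is the prefix, a tuned digit c, then [v], then a huge digit B. Comparison with and
    without the latest digit of [v] isolates one term, whose argument of h is close to [a]. *)
Lemma no_atom_continuous (g : R -> R[i]) (a G c0 : R) (Zt : R[i] -> Prop) :
    ccont_on_11 g -> (forall x, x != 0 -> -1 <= x <= 1 -> g x = h x) ->
    -1 < a < 1 -> (forall x : R, 0 < `|x| <= 1 -> cabs (h x) <= G) ->
    reachable k th Zt -> 0 < c0 ->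
    (forall z, cabs z = 1 -> Zt z -> c0 <= `|phi (z * g a)|) ->
  forall t, mu (fset k th f phi (fun y => y = t)) = 0%E.
Proof.
move=> cg gh /andP[a1 a2] hG reach c00 Hz t; apply/eqP; apply: contrapT => /negP A0.
have G0 : 0 <= G by apply: le_trans (cabs_ge0 (h 1)) (hG 1 _); rewrite normr1 ltr01 lexx.
have dl0 : 0 < (2^-1 : R) < 1 by rewrite invr_gt0 ltr0n /= invf_lt1 // ltr1n.
have h_bound (x : R) : 0 < `|x| <= 1 -> cabs (h x) <= G * expR (`|x| `^ (-1 + 2^-1)).
  move=> /hG /le_trans; apply; rewrite ler_peMr //.
  by apply: le_trans (expR_ge1Dx _); rewrite lerDl powR_ge0.
have [x0 [ix0 x001 [K K0 HK]]] :=
  key_estimate k_gt0 th_root f_shift h_pos h_neg phi_lin dl0 h_bound A0.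
have [L L0 HL] := phi_bound phi_lin.
(* With this tolerance, replacing [g a] by a nearby value of h costs at most c0 / 2 after applying
   phi. *)
have e0 : 0 < c0 / (2 * L) by rewrite divr_gt0 // mulr_gt0.
have [|d d0 Hd] := cg a _ _ e0; first by rewrite !ltW.
(* An irrational target has digits of every order. It approximates |a|; the sign of [a] comes from a
   parity. *)
have [al ial /andP[al1 al2]] : exists2 al : R, irr al &
    Num.max 0 (`|a| - d / 3) < al < Num.min 1 (`|a| + d / 3).
  apply: exists_irr; have na : `|a| < 1 by rewrite ltr_norml a1.
  have na0 : 0 <= `|a| by []. 
  rewrite gt_max !lt_min ltr01 /=; lra.
move: al1 al2; rewrite gt_max lt_min => /andP[al0 ala1] /andP[al1 ala2].
have al01 : 0 < al < 1 by rewrite al0.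
(* Numbers sharing j digits of [al] then differ by at most 1 / q_j^2 <= 2 / j < d / 3. *)
have [j j0 jd] : exists2 j : nat, (0 < j)%N & 6 / d < j%:R.
  by exists (Num.truncn (6 / d)).+1 => //; exact: truncnS_gt.
pose w := dg al j; have pw : posw w := posw_dg j ial al01.
(* Reversal makes the digits of [al] the leading ones of [cy (v ++ c :: P)]. *)
pose v := rev w; have pv : posw v by rewrite all_rev.
have sv : size v = j by rewrite size_rev size_dg.
have [b [v' vE]] : exists b v', v = b :: v' 
  by move: sv j0; case: (v) => [/= jE|b v' _ _]; [rewrite -jE|exists b, v'].
have /andP[b0 pv'] : (0 < b) && posw v' by move: pv; rewrite vE.
have [M HM] := phase_tune th_root 0 reach.
have bR : 0 < b%:~R :> R by rewrite ltr0z.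
pose kx := complex.Re k.
(* The second summand covers phi of the term added by the digit B. *)
pose K' := K + L * G; have K'0 : 0 < K' by rewrite ltr_pwDl // mulr_ge0 // ltW.
(* (b + 1)^(Re k) bounds the ratio of [qk r0] to [qk r], and the 1 stands for [qk r] itself. *)
pose Q := 1 + expR (kx * ln (b%:~R + 1)).
have Q0 : 0 < Q by rewrite ltr_pwDl // expR_ge0.
pose Y := 2 * K' * Q / c0 + 1.
have Y0 : 0 < Y by rewrite ltr_wpDl // divr_ge0 ?mulr_ge0 // ltW.
pose B := (Num.truncn (expR (ln Y / kx))).+1.
have B0 : 0 < B%:R :> R by rewrite ltr0n.
have BE : expR (- kx * ln B%:R) * Y < 1.
  rewrite -[Y in _ * Y]lnK ?posrE // -expRD -[ltRHS]expR0 ltr_expR mulNr addrC subr_lt0.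
  rewrite mulrC -ltr_pdivrMr // -[ltLHS]expRK ltr_ln ?posrE ?expR_gt0 //.
  exact: truncnS_gt.
have [Mv HMv] := seq_bound v.
(* [size r] will be j + n + 1, so the parity chosen for n gives the argument of h the sign of
   [a]. *)
pose M' := maxn (maxn M Mv) (maxn B j.+2).
have [n0 Hn0] := HK M'; have [n nn on] := exists_parity n0 (odd j (+) (a < 0)).
pose P := dg x0 n; have pP : posw P := posw_dg n ix0 x001.
have [c [cp _ cM Zc]] := HM v P pv pP.
pose r := v ++ c :: P; pose r0 := v' ++ c :: P.
have rE : r = b :: r0 by rewrite /r vE.
have pr : posw r by rewrite all_cat pv /= cp.
have pr0 : posw r0 by rewrite all_cat pv' /= cp.
(* The digit B divides the error by B^(Re k): the estimate is applied to the longer word, and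
   removing its last term costs a multiple of the same small power. *)
have near_t l : posw l -> (size l <= j)%N -> all (fun b => b <= Posz Mv) l ->
    `|phi (psum (l ++ c :: P)) - t| <= K' * (qk (l ++ c :: P) * expR (- kx * ln B%:R)).
  move=> pl sl lM; set r1 := l ++ c :: P.
  have pr1 : posw r1 by rewrite all_cat pl /= cp.
  have q10 : 0 < (cq r1)%:~R :> R by rewrite ltr0z cq_gt0.
  have pB : posw (Posz B :: r1) by rewrite /= pr1.
  have H1 : `|phi (psum (Posz B :: r1)) - t| <= K * qk (Posz B :: r1).
    have -> : Posz B :: r1 = (Posz B :: l ++ [:: c]) ++ P by rewrite /r1 /= -catA.
    apply: Hn0 => //.
    - by rewrite /= all_cat pl /= cp.
    - rewrite /= size_cat /= addn1; apply: (@leq_trans j.+2); first by rewrite !ltnS.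
      by rewrite /M' !leq_max leqnn !orbT.
    rewrite /= all_cat /= andbT; apply/and3P; split.
    - by rewrite lez_nat /M' !leq_max leqnn !orbT.
    - apply: sub_all lM => z /le_trans; apply; by rewrite lez_nat /M' !leq_max leqnn !orbT.
    - by apply: le_trans cM _; rewrite lez_nat /M' !leq_max leqnn.
  have yb : 0 < `|(-1) ^+ (size (Posz B :: r1)).+1 * ratr (cy (Posz B :: r1)) : R| <= 1.
    have y0 : 0 < ratr (cy (Posz B :: r1)) :> R by rewrite ltr0q cy_gt0.
    have /andP[_ y1] := cy_bounds pB.
    by rewrite normrMsign gtr0_norm // y0 andTb -[leRHS](rmorph1 (ratr : rat -> R)) ler_rat.
  have H2 : cabs (trm (Posz B :: r1)) <= qk (Posz B :: r1) * G.
    by rewrite cabs_trm // ler_wpM2l ?expR_ge0 // hG.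
  have H3 : qk (Posz B :: r1) <= qk r1 * expR (- kx * ln B%:R).
    rewrite !qkE -expRD ler_expR -/kx -mulrDr !mulNr lerN2 ler_pM2l //.
    rewrite addrC -lnM ?posrE // ler_ln ?posrE ?mulr_gt0 //; last by rewrite ltr0z cq_gt0.
    rewrite cq_cons rmorphD rmorphM /= lerDl ler0z; by have [] := cq_bounds pr1.
  have -> : phi (psum r1) - t = (phi (psum (Posz B :: r1)) - t) - phi (trm (Posz B :: r1)).
    by rewrite psum_cons (phiD phi_lin); ring.
  apply: le_trans (ler_normB _ _) _.
  apply: (@le_trans _ _ (K' * qk (Posz B :: r1))); last by rewrite ler_pM2l.
  rewrite /K' mulrDl lerD // -mulrA [G * _]mulrC; apply: le_trans (HL _) _.
  by rewrite ler_pM2l.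
have E1 := near_t v pv; rewrite sv leqnn -/r in E1; have {}E1 := E1 isT HMv.
have E0 : `|phi (psum r0) - t| <= K' * (qk r0 * expR (- kx * ln B%:R)).
  apply: near_t => //; first by move: sv; rewrite vE /= => <-.
  by move: HMv; rewrite vE /= => /andP[].
have q0 : 0 < (cq r0)%:~R :> R by rewrite ltr0z cq_gt0.
have qr0 : 0 < (cq r)%:~R :> R by rewrite ltr0z cq_gt0.
have qk0 : qk r0 <= qk r * expR (kx * ln (b%:~R + 1)).
  rewrite !qkE -expRD ler_expR -/kx !mulNr addrC -mulrBr -mulrN ler_pM2l // lerBrDr addrC lerBlDr.
  rewrite -lnM ?posrE // ?ltr_wpDr // ler_ln ?posrE ?mulr_gt0 ?ltr_wpDr //.
  have [_ h1 h2] := cq_bounds pr0.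
  rewrite rE cq_cons rmorphD rmorphM /= mulrDl mul1r lerD2l ler_int //.
pose y : R := ratr (cy r).
have y0 : 0 < y by rewrite /y rE ltr0q cy_gt0 // -rE.
have y1 : y <= 1.
  by rewrite /y -[1](rmorph1 (ratr : rat -> R)) ler_rat; have /andP[] := cy_bounds pr.
have yal : `|y - al| < d / 3.
  have -> : y = mob w (ratr (cy (c :: P))) by rewrite /y /r cy_cat ratr_mob revK.
  rewrite -[X in _ - X](mob_dg j ial al01) -/w.
  have pcP : posw (c :: P) by rewrite /= cp.
  apply: le_lt_trans (mob_dist pw _ _) _.
  - have /andP[h1 h2] := cy_bounds pcP.
    by rewrite ler0q h1 -[1](rmorph1 (ratr : rat -> R)) ler_rat.
  - by have /andP[h1 h2] := iter_itv j ial al01; rewrite !ltW.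
  have wq := ge_cq_dg j ial al01; rewrite -/w in wq.
  have qw : 0 < (cq w)%:~R :> R by rewrite ltr0z cq_gt0.
  rewrite ltr_pdivrMr ?exprn_gt0 //.
  rewrite ltr_pdivrMr // in jd.
  by have := ler_wpM2r (ltW d0) wq; move: jd; prune; lra.
pose sg : R := (-1) ^+ (size r).+1.
have sgE : sg = (-1) ^+ (a < 0)%R.
  rewrite /sg /r size_cat /= sv size_dg addnS !exprS !mulN1r opprK -signr_odd oddD on.
  by case: (odd j); case: (a < 0).
have aE : a = sg * `|a|.
  rewrite sgE; case: (ltP a 0) => ha; first by rewrite expr1 mulN1r ltr0_norm // opprK.
  by rewrite expr0 mul1r ger0_norm.
have ya : `|sg * y - a| < d.
  rewrite {1}aE -mulrBr /sg normrMsign.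
  by move: yal; rewrite !ltr_norml => /andP[h1 h2]; move: h1 h2 ala1 ala2; prune; lra.
have sgy : `|sg * y| = y by rewrite /sg normrMsign gtr0_norm.
have sgy1 : -1 <= sg * y <= 1 by rewrite -ler_norml sgy.
have hE : h (sg * y) = g (sg * y).
  by rewrite gh // -normr_gt0 sgy.
have gc := Hd _ sgy1 ya.
have ph : c0 / 2 <= `|phi (phase r * h (sg * y))|.
  have h1 : c0 <= `|phi (phase r * g a)| by apply: Hz => //; exact: cabs_phase.
  have h2 : `|phi (phase r * (g (sg * y) - g a))| <= c0 / 2.
    apply: le_trans (HL _) _; rewrite cabsM (cabs_phase _ th_root) mul1r.
    apply: le_trans (ler_wpM2l (ltW L0) (ltW gc)) _.
    by rewrite le_eqVlt; apply/orP; left; apply/eqP; field; rewrite gt_eqF.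
  have h3 : phi (phase r * g a) = phi (phase r * h (sg * y)) - phi (phase r * (g (sg * y) - g a)).
    by rewrite -(phiB phi_lin) hE; congr phi; ring.
  have h4 := ler_normB (phi (phase r * h (sg * y))) (phi (phase r * (g (sg * y) - g a))).
  by rewrite h3 in h1; move: h1 h2 h4; prune; lra.
have diff : phi (psum r) - phi (psum r0) = qk r * phi (phase r * h (sg * y)).
  rewrite -(phiB phi_lin) {1}rE psum_cons -rE addrC addKr trm_polar (phiZ phi_lin) //.
have qkp : 0 < qk r by exact: expR_gt0.
(* The triangle inequality through t gives this bound, which the choice of B contradicts: K' Q
   B^(-Re k) < c0 / 2. *)
have : qk r * (c0 / 2) <= K' * (qk r * expR (- kx * ln B%:R)) + K' * (qk r0 * expR (- kx * ln B%:R)).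
  apply: (@le_trans _ _ `|phi (psum r) - phi (psum r0)|).
    by rewrite diff normrM gtr0_norm // ler_pM2l.
  by rewrite -(subrKA t); apply: le_trans (ler_normD _ _) _; rewrite lerD // distrC.
apply/negP; rewrite -ltNge; set E := expR _ in BE *.
have Ep : 0 < E by exact: expR_gt0.
apply: (@le_lt_trans _ _ (qk r * (K' * Q * E))).
  have := ler_wpM2l (ltW (mulr_gt0 K'0 Ep)) qk0.
  rewrite /Q; move: (expR _) => Z; prune; lra.
rewrite ltr_pM2l //.
have h1 : c0 * (E * Y) < c0 * 1 by rewrite ltr_pM2l.
have h2 : c0 * (E * Y) = 2 * (K' * Q * E) + c0 * E by rewrite /Y; field; rewrite gt_eqF.
have h3 : 0 < c0 * E by rewrite mulr_gt0.
by move: h1 h2 h3; prune; lra.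
Qed.

End NoAtoms.

(** * Bounds, choice of a phase, and assembly *)

Section Conclusion.
Local Open Scope classical_set_scope.
Variable R : realType.

Lemma ccont_bounded (g : R -> R[i]) : ccont_on_11 g ->
  exists G, forall x, -1 <= x <= 1 -> cabs (g x) <= G.
Proof.
move=> cg; have [||c _ Hc] := @EVT_max R (fun x => cabs (g x)) (-1) 1.
- lra.
- apply/subspace_continuousP => x; rewrite /= in_itv /= => x11.
  apply: (@cvgrPdist_lt _ _ _ _ _ (fun y => cabs (g y)) (cabs (g x))).2 => e e0.
  have [d d0 Hd] := cg x x11 e e0.
  rewrite near_withinE; apply/nbhs_ballP; exists d => //= y.
  rewrite -ball_normE /= distrC in_itv /= => xy y11.
  have := Hd y y11 xy; apply: le_lt_trans; rewrite ler_norml.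
  have h1 := cabsD (g x - g y) (g y); have h2 := cabsD (g y - g x) (g x).
  rewrite !subrK in h1 h2; rewrite cabsBC in h1.
  by rewrite /from_subspace; lra.
by exists (cabs (g c)) => x x11; apply: Hc; rewrite in_itv.
Qed.

Lemma powR_gt_self (e : R) : 0 < e < 1 -> e < e `^ (2 / 3).
Proof.
move=> e01; have l0 := ln_lt0 e01; have /andP[e0 _] := e01.
rewrite /powR gt_eqF // -[ltLHS]lnK ?posrE // ltr_expR; lra.
Qed.

(** Rotations and positive real multiples of [w] reach every nonzero complex number, and phi is
    homogeneous over the reals. *)
Lemma phase_witness (phi : R[i] -> R) (w : R[i]) :
    (forall (r : R) (z w : R[i]), phi ((r%:C)%C * z + w) = r * phi z + phi w) ->
    (exists z, phi z <> 0) -> w <> 0 ->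
  exists b, phi (eC b * w) != 0.
Proof.
move=> phi_lin [z z0] w0; pose q := z / w.
have zE : z = q * w by rewrite divfK //; apply/eqP.
have q0 : cabs q != 0.
  by apply/eqP => /cabs_eq0 q0; apply: z0; rewrite zE q0 mul0r (phi0 phi_lin).
have qC0 : ((cabs q)%:C)%C != 0 :> R[i] by apply/eqP => -[] /eqP; rewrite (negbTE q0).
have q1 : cabs (q / ((cabs q)%:C)%C) = 1.
  by rewrite cabsM cabsV cabs_real ger0_norm ?cabs_ge0 // divff.
have [b bE] := cabs1_eC q1; exists b; apply/eqP => b0; apply: z0.
have -> : z = ((cabs q)%:C)%C * (eC b * w) by rewrite -bE mulrA [_ * (q / _)]mulrC divfK.
by rewrite (phiZ phi_lin) b0 mulr0.
Qed.

End Conclusion.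

Unset Implicit Arguments. Set Strict Implicit.

Theorem theorem3p5 (R : realType) (k th : R[i]) (f : rat -> R[i]) (h : R -> R[i])
  (phi : R[i] -> R)
  (hk : 0 < complex.Re k)
  (hth : exists n : nat, (0 < n)%N /\ th ^+ n = 1)
  (hf : forall x : rat, f (x + 1) = th * f x)
  (hhpos : forall x : rat, 0 < x ->
     h (ratr x) = f x - th ^ 3%:Z * cpow (ratr `|x|) (- k) * f (- x^-1))
  (hhneg : forall x : rat, x < 0 ->
     h (ratr x) = f x - th ^ (- 3)%Z * cpow (ratr `|x|) (- k) * f (- x^-1))
  (hphi : forall (r : R) (z w : R[i]), phi ((r%:C)%C * z + w) = r * phi z + phi w)
  (hphi0 : exists z, phi z <> 0)
  (hyp :
    (* condition (1-star) *)
    (exists g : R -> R[i],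
       ccont_on_11 g /\ (forall x, x != 0 -> -1 <= x <= 1 -> g x = h x) /\
       ((complex.Im k = 0 /\ exists (p : int) (a : R), -1 < a < 1 /\ phi (th ^ p * g a) <> 0)
        \/ (complex.Im k <> 0 /\ exists a : R, -1 < a < 1 /\ g a <> 0)))
    \/
    (* condition (2-star), with sign s = +1 or -1 *)
    (exists s : R, (s = 1 \/ s = -1) /\
       (forall M : R, exists2 d : R, 0 < d & forall x, 0 < s * x < d -> M < cabs (h x)) /\
       (exists dl : R, 0 < dl < 1 /\ exists C : R, forall x, 0 < `|x| <= 1 ->
          cabs (h x) <= C * expR (`|x| `^ (-1 + dl))) /\
       ((complex.Im k = 0 /\ exists p : int, exists2 e0 : R, 0 < e0 & forall e : R, 0 < e < e0 ->
           exists2 c : R, 0 < c & exists2 d : R, 0 < d & forall x, 0 < s * x < d ->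
             forall u : R, 0 < u -> e < `|ln u| < e `^ (2 / 3) ->
               c <= `|phi (th ^ p * ((h x - cpow u k * h (u * x)) / ((cabs (h x))%:C)%C))|)
        \/
        (complex.Im k <> 0 /\ exists b : R, exists2 e0 : R, 0 < e0 & forall e : R, 0 < e < e0 ->
           exists2 c : R, 0 < c & exists2 d : R, 0 < d & forall x, 0 < s * x < d ->
             forall u a : R, 0 < u -> e < `|ln u| < e `^ (2 / 3) -> `|a - b| < e `^ (2 / 3) ->
               c <= `|phi (eC a * ((h x - cpow u k * h (u * x)) / ((cabs (h x))%:C)%C))|))))
  :
  {ae (@lebesgue_measure R), forall x, 0 < x < 1 -> exists l, fstar_is th k f x l}
  /\ (forall t : R, measurable [set x : R | exists l, fstar_is th k f x l /\ phi l <= t])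
  /\ continuous (fun t : R =>
       (@lebesgue_measure R) [set x : R | exists l, fstar_is th k f x l /\ phi l <= t]).
Proof.
(* A growth bound on h and the absence of atoms give all three conclusions, whichever hypothesis
   holds. *)
suff [dl [C [dl0 [h_bound no_atom]]]] : exists dl C : R, 0 < dl < 1 /\
    (forall x : R, 0 < `|x| <= 1 -> cabs (h x) <= C * expR (`|x| `^ (-1 + dl))) /\
    forall t, lebesgue_measure (fset k th f phi (fun y => y = t)) = 0%E.
  split; first exact: (fstar_ae hk hth hf hhpos hhneg dl0 h_bound).
  split; first exact: (measurable_fset_le hk hth hf hhpos hhneg hphi).
  exact: (cdf_continuous hk hth hf hhpos hhneg hphi no_atom).
case: hyp => [[g [cg [gh hg]]]|[s [s1 [h_inf [[dl [dl0 [C h_bound]]] hg]]]]].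
  have [G HG] := ccont_bounded cg.
  have hG (x : R) : 0 < `|x| <= 1 -> cabs (h x) <= G.
    by rewrite normr_gt0 ler_norml => /andP[x0 x1]; rewrite -gh //; apply: HG.
  (* For bounded h any exponent in (0, 1) would do. *)
  exists 2^-1, G; split; first by rewrite invr_gt0 ltr0n /= invf_lt1 // ltr1n.
  split.
    have G0 : 0 <= G by apply: le_trans (cabs_ge0 (g 0)) (HG 0 _); lra.
    move=> x /hG /le_trans; apply; rewrite ler_peMr //.
    by apply: le_trans (expR_ge1Dx _); rewrite lerDl powR_ge0.
  case: hg => [[k0 [p [a [a1 pa]]]]|[k0 [a [a1 ga0]]]].
    apply: (@no_atom_continuous R k th f h phi hk hth hf hhpos hhneg hphi g a G
      `|phi (th ^ p * g a)| (fun z => z = th ^ p)) => //.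
    - by left; split => //; exists p.
    - by rewrite normr_gt0; apply/eqP.
    - by move=> z _ ->.
  have [b bne] := phase_witness hphi hphi0 ga0.
  have [L L0 HL] := phi_bound hphi.
  (* Half of the value at b survives on a small arc around b. *)
  pose c0 := `|phi (eC b * g a)| / 2.
  have c00 : 0 < c0 by rewrite divr_gt0 // normr_gt0.
  have Lg : 0 < L * (1 + cabs (g a)) by rewrite mulr_gt0 // ltr_pwDl // cabs_ge0.
  have [|d d0 Hd] := @eC_continuous R b (c0 / (L * (1 + cabs (g a)))); first exact: divr_gt0.
  apply: (@no_atom_continuous R k th f h phi hk hth hf hhpos hhneg hphi g a G
    c0 (fun z => exists2 a', `|a' - b| < d & z = eC a')) => //.
  - by right; split => //; exists b, d; split => // a' a'd; exists a'.
  - move=> z _ [a' /Hd a'd ->].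
    have h1 : `|phi ((eC a' - eC b) * g a)| <= c0.
      apply: le_trans (HL _) _; rewrite cabsM.
      move: a'd; rewrite ltr_pdivlMr // => a'd; apply: le_trans (ltW a'd).
      have := cabs_ge0 (eC a' - eC b); have := cabs_ge0 (g a).
      move: (cabs (eC a' - eC b)) (cabs (g a)) => u v v0 u0.
      have -> : u * (L * (1 + v)) = L * (u * (1 + v)) by ring.
      by rewrite ler_pM2l //; apply: ler_wpM2l => //; lra.
    have h2 : phi (eC b * g a) = phi (eC a' * g a) - phi ((eC a' - eC b) * g a).
      by rewrite -(phiB hphi); congr phi; ring.
    have := ler_normB (phi (eC a' * g a)) (phi ((eC a' - eC b) * g a)).
    by rewrite -h2; rewrite /c0 in h1 *; lra.
exists dl, C; split => //; split => //.
(* A single e is enough; taken below 1, it leaves the window (e, e^(2/3)) nonempty. *)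
have sub_e (e0 : R) : 0 < e0 -> exists2 e, 0 < e < e0 & e < e `^ (2 / 3).
  move=> e00; have em0 : 0 < Num.min e0 1 by rewrite lt_min e00 ltr01.
  have em1 : Num.min e0 1 <= 1 by rewrite ge_min lexx orbT.
  have em2 : Num.min e0 1 <= e0 by rewrite ge_min lexx.
  by exists (Num.min e0 1 / 2); [|apply: powR_gt_self]; rewrite divr_gt0 //=; lra.
case: hg => [[k0 [p [e0 /sub_e[e ee0 ee] He]]]|[k0 [b [e0 /sub_e[e ee0 ee] He]]]].
  have [c c0 [d d0 Hcd]] := He e ee0; have /andP[ep _] := ee0.
  apply: (@no_atom_unbounded R k th f h phi hk hth hf hhpos hhneg hphi dl C s e (e `^ (2 / 3)) c d
    (fun z => z = th ^ p)) => //.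
  - by left; split => //; exists p.
  - by rewrite ep.
  - by move=> x u z sx u0 lu ->; apply: Hcd.
have [c c0 [d d0 Hcd]] := He e ee0; have /andP[ep _] := ee0.
apply: (@no_atom_unbounded R k th f h phi hk hth hf hhpos hhneg hphi dl C s e (e `^ (2 / 3)) c d
  (fun z => exists2 a, `|a - b| < e `^ (2 / 3) & z = eC a)) => //.
- right; split => //; exists b, (e `^ (2 / 3)); split; first exact: powR_gt0.
  by move=> a ab; exists a.
- by rewrite ep.
- by move=> x u z sx u0 lu [a ab ->]; apply: Hcd.
Qed.
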